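(* Let $n\ge1$, $0<p<1$, $\nu\in\mathbb{R}$, $\sigma\in J_n^+$, and let $V(x,t)=\zeta(t)(1+t)^\nu|x|^\sigma$ where $\zeta>0$ is continuous with $\lim_{t\to\infty}t^\delta\zeta(t)=\infty$ and $\lim_{t\to\infty}t^{-\delta}\zeta(t)=0$ for every $\delta>0$, and, in case $\sigma>0$, $\zeta(t)(1+t)^\nu\in\mathcal{E}_\varepsilon$ for some $\varepsilon\in(0,1)$. Set $a_0=\frac{\sigma}{1-p}$ and $a_c=\frac{\sigma+2(\nu+1)_+}{1-p}$. Let $u_0\ge0$ be continuous with $$\liminf_{|x|\to\infty}|x|^{-a}u_0(x)=l_1,\qquad\limsup_{|x|\to\infty}|x|^{-a}u_0(x)=l_2,\qquad l_1,l_2\in(0,\infty),$$ where $a\in(a_c,\infty)$. Let $u$ be the global s-solution of $\partial_tu-\Delta\partial_tu=\Delta u+Vu^p$, $u(\cdot,0)=u_0$, and fix $R>0$. Then there are constants $\underline C,\overline C>0$ such that $$\underline C\,l_1\,t^{a/2}\le\|u(\cdot,t)\|_{R,a}\le\overline C\,l_2\,t^{a/2}\quad\text{for all sufficiently large }t.$$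
   Context: $J_n^+=\{0\}\cup[1,\infty)$ if $n=1$, $[0,\infty)$ if $n\ge2$; $s_+=\max\{s,0\}$. $\|\varphi\|_{R,a}=\sup_x(R^2+|x|^2)^{-a/2}|\varphi(x)|$. $\mathcal{E}_\varepsilon$ is the set of continuous positive $\Lambda$ for which there are $c,t_0>0$ with $\int_0^{\varepsilon t}\Lambda\ge c\int_0^t\Lambda$ for all $t\ge t_0/\varepsilon$. $\mathcal{B}\varphi=B*\varphi$ with $B=\mathcal{F}^{-1}((1+|\xi|^2)^{-1})$. With $\tilde a=\max\{a_0,a\}$, a global s-solution is $u\ge0$ with $\mu=e^tu\in C([0,\infty);BC_{\tilde a})$ ($BC_{\tilde a}$: continuous functions bounded by $C|x|^{\tilde a}$ at infinity) and $\mu(t)=u_0+\int_0^t\mathcal{B}\mu\,d\tau+\int_0^te^{(1-p)\tau}\mathcal{B}[V\mu^p]\,d\tau$; it exists and is unique under these hypotheses. *)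

(* Defs.v *)
From HB Require Import structures.
From mathcomp Require Import all_boot all_order all_algebra.
From mathcomp Require Import all_classical all_reals all_analysis.
Set Implicit Arguments. Unset Strict Implicit. Unset Printing Implicit Defensive.
Import Order.TTheory GRing.Theory Num.Theory.
Import numFieldNormedType.Exports.
Local Open Scope classical_set_scope.
Local Open Scope ring_scope.

Section Defs.
Variable R : realType.

Definition enorm (n : nat) (x : 'rV[R]_n) : R :=
  Num.sqrt (\sum_(i < n) x ord0 i ^+ 2).

(* Lebesgue integral over R^n of a function with values in \bar R, defined
   as the iterated one-dimensional Lebesgue integral (for the nonnegative
   measurable integrands used below this is the integral w.r.t. Lebesgue
   measure on R^n, by Tonelli). *)
Fixpoint intRn (n : nat) : ('rV[R]_n -> \bar R) -> \bar R :=
  match n with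
  | 0 => fun f => f 0
  | m.+1 => fun f =>
      (\int[@lebesgue_measure R]_(s in [set: R])
          intRn (fun y : 'rV[R]_m => f (row_mx (\row_(j < 1) s) y)))%E
  end.

(* The Bessel kernel B = F^{-1}((1+|xi|^2)^{-1}) on R^n, given by its
   standard heat-kernel (subordination) representation
   B(x) = int_0^oo e^{-s} (4 pi s)^{-n/2} e^{-|x|^2/(4s)} ds. *)
Definition Bker (n : nat) (x : 'rV[R]_n) : R :=
  fine (\int[@lebesgue_measure R]_(s in `]0%R, +oo[)
     (expR (- s) * (4 * pi * s) `^ (- (n%:R / 2))
        * expR (- (enorm x ^+ 2) / (4 * s)))%:E)%E.

Definition Bop (n : nat) (phi : 'rV[R]_n -> R) : 'rV[R]_n -> R :=
  fun x => fine (intRn (fun y => (Bker (x - y) * phi y)%:E)).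

Definition int0 (t : R) (g : R -> R) : R :=
  fine (\int[@lebesgue_measure R]_(tau in `[0%R, t]) (g tau)%:E)%E.

Definition wnorm (n : nat) (R0 a : R) (phi : 'rV[R]_n -> R) : R :=
  sup [set (R0 ^+ 2 + enorm x ^+ 2) `^ (- (a / 2)) * `|phi x| | x in [set: 'rV[R]_n]].

Definition BC (n : nat) (a : R) (phi : 'rV[R]_n -> R) : Prop :=
  continuous phi /\
  exists C M : R, forall x, M <= enorm x -> `|phi x| <= C * enorm x `^ a.

Definition C0BC (n : nat) (a : R) (mu : R -> 'rV[R]_n -> R) : Prop :=
  (forall t, 0 <= t -> BC a (mu t)) /\
  (forall t, 0 <= t -> forall eps, 0 < eps -> exists2 d, 0 < d &
     forall s, 0 <= s -> `|s - t| < d -> wnorm 1 a (fun x => mu s x - mu t x) < eps).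

(* Global s-solution of  u_t - Lap u_t = Lap u + V u^p,  u(.,0) = u0,
   with mu = e^t u and V : R^n -> [0,oo) -> R. *)
Definition global_s_solution (n : nat) (p a0 a : R)
    (V : 'rV[R]_n -> R -> R) (u0 : 'rV[R]_n -> R) (u : R -> 'rV[R]_n -> R) : Prop :=
  let at_ := Num.max a0 a in
  let mu := fun t x => expR t * u t x in
  (forall t x, 0 <= t -> 0 <= u t x) /\
  C0BC at_ mu /\
  forall t x, 0 <= t ->
    mu t x = u0 x + int0 t (fun tau => Bop (mu tau) x)
             + int0 t (fun tau => expR ((1 - p) * tau) *
                         Bop (fun y => V y tau * (mu tau y) `^ p) x).

Definition E_class (eps : R) (Lam : R -> R) : Prop :=
  {within `[0%R, +oo[, continuous Lam} /\ (forall t, 0 <= t -> 0 < Lam t) /\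
  exists c t0 : R, 0 < c /\ 0 < t0 /\
    forall t, t0 / eps <= t -> c * int0 t Lam <= int0 (eps * t) Lam.

Definition Jplus (n : nat) (s : R) : Prop :=
  if n == 1%N then s = 0 \/ 1 <= s else 0 <= s.

(* inf / sup of g over {|x| >= r}, in \bar R (used for liminf/limsup as |x|->oo) *)
Definition inf_outside (n : nat) (g : 'rV[R]_n -> R) (r : R) : \bar R :=
  ereal_inf [set (g x)%:E | x in [set x | r <= enorm x]].
Definition sup_outside (n : nat) (g : 'rV[R]_n -> R) (r : R) : \bar R :=
  ereal_sup [set (g x)%:E | x in [set x | r <= enorm x]].

End Defs.

(* Main.v *)
Require Import Defs.
From HB Require Import structures.
From mathcomp Require Import all_boot all_order all_algebra.
From mathcomp Require Import all_classical all_reals all_analysis.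
From mathcomp Require Import measurable_realfun ring lra.
Import Order.TTheory GRing.Theory Num.Theory.
Import numFieldNormedType.Exports.
Local Open Scope classical_set_scope.
Local Open Scope ring_scope.

(** The kernel [B] is the exponential mixture of heat kernels, hence a symmetric
    probability density with all moments, and on a function of one coordinate it
    acts through its one-dimensional marginal.

    Upper bound.  Fix [T >= 1] and put
    [Phi x = (\sum_i (T^N + x_i^(2N)))^(a/2N)], which is comparable to
    [(T + |x|^2)^(a/2)].  Symmetry and the concavity of the outer power give
    [B * Phi <= (1 + C/T) Phi], and [a > a_c] gives
    [V Phi^p <= C T^(-m) (1 + t)^(m-1) Phi] with [2m = a(1-p) - sigma].  Hence
    [A e^(E t) Phi], where [E t = (1 + C/T) t + K T^(-m) ((1 + t)^m - 1)], is a
    supersolution on [[0, T]], and [E T - T] is bounded in [T].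

    Lower bound.  [cos (k x_1)] is an eigenfunction of [B] with eigenvalue [lam],
    [1 - lam >= c k^2], so [e^t cos 1 - e^(lam t) cos (k x_1)] solves the linear
    equation.  With [k = 1/r] its initial value is bounded and nonpositive for
    [|x_1| <= r], hence lies below a multiple of [r^(-a) u0]; take [r] of order
    [sqrt t] and evaluate at the origin.

    Both comparisons improve an a priori bound iteratively; all integrands are
    nonnegative and the integral is monotone without measurability, so no
    measurability of the solution is needed. *)

Set Implicit Arguments. Unset Strict Implicit. Unset Printing Implicit Defensive.

(** * Iterated integrals *)

(** The power [u^p] is not Lipschitz at 0, so Gronwall's argument does not apply directly. Its place
    is taken by sublinearity: once a bound [X] satisfies [X >= e^s], the source factor
    [e^((1-p)s) X^p] is at most [X], hence multiples of the supersolution by constants [>= 1] are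
    again supersolutions, and each iteration gains the excess over the initial datum.

    The weight is polynomial in each coordinate because [B] then acts through its one-dimensional
    marginal and only even moments enter; an outer power at most 1 restores the growth [|x|^a]. Its
    length scale [sqrt T] is tied to the final time: a relative error [C/T] of [B], kept up for a
    time [T], costs a bounded factor. So the comparison is made anew for every [T] and read off at
    time [T] only.

    In the lower bound a frequency of order [T^(-1/2)] gives [(1 - lam) T] of order one, and the
    nonnegative source is dropped.

    A technical obstacle is that the kernel integral is infinite at the origin for [n >= 2], where
    [fine] returns 0. Estimates are therefore made for the extended-valued [bessel] and transferred
    to [Bker] off a null set. *)

Section integral_general.
Context d (T : measurableType d) (R : realType).
Variable mu : {measure set T -> \bar R}.
Local Open Scope ereal_scope.

(** [integral] is a difference of two suprema over simple functions, for the positive and the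
    negative part; each supremum is monotone, measurable or not. *)
Lemma le_integral_pointwise (D : set T) (f g : T -> \bar R) :
  (forall x, D x -> f x <= g x) ->
  \int[mu]_(x in D) f x <= \int[mu]_(x in D) g x.
Proof.
move=> fg.
have fgD x : (f \_ D) x <= (g \_ D) x.
  by rewrite !patchE; case: ifPn => // /set_mem/fg.
rewrite /integral; apply: leeB; apply: ereal_sup_le => _ [h /= hf <-];
  exists h => // x; apply: (le_trans (hf x)).
  by rewrite !funeposE ge_max !le_max fgD lexx orbT.
by rewrite !funenegE ge_max !le_max leeN2 fgD lexx orbT.
Qed.

End integral_general.

(** * Measurability and Tonelli for the iterated integral *)

Section parametric.
Variable R : realType.
Local Open Scope ereal_scope.
Notation leb := (@lebesgue_measure R).
Notation MR := (measurableTypeR R).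

(* Measurability of [F : T * R^m -> \bar R] with ['rV_m] carrying no
   sigma-algebra: measurability along every measurable family of points. *)
Definition pmeasurable d (T : measurableType d) m (F : T -> 'rV[R]_m -> \bar R) :=
  forall d' (T' : measurableType d') (h : T' -> T) (c : T' -> 'rV[R]_m),
    measurable_fun setT h ->
    (forall i, measurable_fun setT ((fun t => c t ord0 i) : T' -> MR)) ->
    measurable_fun setT ((fun t => F (h t) (c t)) : T' -> \bar R).

Lemma row_mx1_ord0 m (s : R) (y : 'rV[R]_m) :
  (row_mx (\row_(j < 1) s) y) ord0 ord0 = s.
Proof.
have -> : ord0 = lshift m (ord0 : 'I_1) by apply/val_inj.
by rewrite row_mxEl mxE.
Qed.

Lemma row_mx1_lift m (s : R) (y : 'rV[R]_m) i :
  (row_mx (\row_(j < 1) s) y) ord0 (lift ord0 i) = y ord0 i.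
Proof.
have -> : lift ord0 i = rshift 1 i by apply/val_inj.
by rewrite row_mxEr.
Qed.

(** The induction step for [intRn]: the first coordinate moves from the row into the parameter
    space. *)
Lemma pmeasurable_row d (T : measurableType d) m (F : T -> 'rV[R]_m.+1 -> \bar R) :
  pmeasurable F ->
  pmeasurable (fun (ts : T * MR) y => F ts.1 (row_mx (\row_(j < 1) ts.2) y)).
Proof.
move=> mF d' T' h c mh mc; apply: mF.
  exact: (measurableT_comp measurable_fst mh).
move=> i; case: (unliftP ord0 i) => [j|] ->.
  by under eq_fun do rewrite row_mx1_lift; exact: mc.
under eq_fun do rewrite row_mx1_ord0.
exact: (measurableT_comp measurable_snd mh).
Qed.

Lemma intRn_ge0 m (F : 'rV[R]_m -> \bar R) : (forall y, 0 <= F y) -> 0 <= intRn F.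
Proof.
elim: m F => [|m IH] F F0 //=; apply: integral_ge0 => s _; exact: IH.
Qed.

Lemma le_intRn m (F G : 'rV[R]_m -> \bar R) :
  (forall y, F y <= G y) -> intRn F <= intRn G.
Proof.
elim: m F G => [|m IH] F G FG //=; apply: le_integral_pointwise => s _; exact: IH.
Qed.

(** The parameter space gains a factor [R] at each step of the induction on [m], hence the arbitrary
    [T]. *)
Lemma measurable_intRn d (T : measurableType d) m (F : T -> 'rV[R]_m -> \bar R) :
  pmeasurable F -> (forall t y, 0 <= F t y) ->
  measurable_fun setT (fun t => intRn (F t)).
Proof.
elim: m d T F => [|m IH] d T F mF F0 /=.
  apply: (mF _ _ id (fun=> 0%R)) => // i; exact: measurable_cst.
have := @measurable_fun_fubini_tonelli_F _ _ _ MR _ leb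
  (fun ts : T * MR => intRn (fun y => F ts.1 (row_mx (\row_(j < 1) ts.2) y))).
apply => [|ts]; last exact: intRn_ge0.
by apply: IH => //; exact: pmeasurable_row.
Qed.

Lemma pmeasurable_slice d (T : measurableType d) m (F : T -> 'rV[R]_m -> \bar R) d2
   (T2 : measurableType d2) (k : T2 -> T) :
  pmeasurable F -> measurable_fun setT k -> pmeasurable (fun t => F (k t)).
Proof. by move=> mF mk d' T' h c mh mc; apply: mF => //; exact: measurableT_comp. Qed.

Definition rV_measurable m (F : 'rV[R]_m -> \bar R) := pmeasurable (fun _ : unit => F).

Lemma rV_measurable_row m (F : 'rV[R]_m.+1 -> \bar R) : rV_measurable F ->
  pmeasurable (fun (s : MR) y => F (row_mx (\row_(j < 1) s) y)).
Proof.
move=> /pmeasurable_row mF.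
by apply: (@pmeasurable_slice _ _ _ _ _ _ (fun s : MR => (tt, s)) mF); exact: measurable_pair1.
Qed.

Lemma rV_measurable_row_at m (F : 'rV[R]_m.+1 -> \bar R) s : rV_measurable F ->
  rV_measurable (fun y => F (row_mx (\row_(j < 1) s) y)).
Proof.
move=> /rV_measurable_row mF; apply: (@pmeasurable_slice _ _ _ _ _ _ (fun=> s) mF).
exact: measurable_cst.
Qed.

Lemma intRnD m (F G : 'rV[R]_m -> \bar R) : rV_measurable F -> rV_measurable G ->
  (forall y, 0 <= F y) -> (forall y, 0 <= G y) ->
  intRn (fun y => F y + G y) = intRn F + intRn G.
Proof.
elim: m F G => [|m IH] F G mF mG F0 G0 //=.
rewrite -ge0_integralD//.
- by apply: eq_integral => s _; apply: IH => //; exact: rV_measurable_row_at.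
- by move=> s _; exact: intRn_ge0.
- by apply: measurable_intRn => //; exact: rV_measurable_row.
- by move=> s _; exact: intRn_ge0.
- by apply: measurable_intRn => //; exact: rV_measurable_row.
Qed.

Lemma intRnZl m (k : \bar R) (F : 'rV[R]_m -> \bar R) : rV_measurable F ->
  (forall y, 0 <= F y) -> 0 <= k ->
  intRn (fun y => k * F y) = k * intRn F.
Proof.
elim: m F => [|m IH] F mF F0 k0 //=.
rewrite -ge0_integralZl//.
- by apply: eq_integral => s _; apply: IH => //; exact: rV_measurable_row_at.
- by apply: measurable_intRn => //; exact: rV_measurable_row.
- by move=> s _; exact: intRn_ge0.
Qed.

Lemma intRn_swap m (F : MR -> 'rV[R]_m -> \bar R) : pmeasurable F ->
  (forall s y, 0 <= F s y) ->
  intRn (fun y => \int[leb]_s F s y) = \int[leb]_s intRn (F s).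
Proof.
elim: m F => [|m IH] F mF F0 //=.
have mF2 : pmeasurable (fun (ts : MR * MR) y => F ts.1 (row_mx (\row_(j < 1) ts.2) y)).
  exact: pmeasurable_row.
rewrite (@fubini_tonelli _ _ MR MR R leb leb
  (fun ts => intRn (fun y => F ts.1 (row_mx (\row_(j < 1) ts.2) y))))/=.
- apply: eq_integral => s _; apply: (IH (fun t y => F t (row_mx (\row_(j < 1) s) y))) => //.
  exact: (@pmeasurable_slice _ _ _ _ _ _ (fun t : MR => (t, s)) mF2).
- exact: measurable_intRn.
- by move=> ts; exact: intRn_ge0.
Qed.

Lemma intRn_prod m (f : 'I_m -> R -> R) :
  (forall i, measurable_fun setT (f i : MR -> MR)) -> (forall i x, 0 <= f i x)%R ->
  intRn (fun y : 'rV[R]_m => (\prod_(i < m) f i (y ord0 i))%:E) =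
  \prod_(i < m) \int[leb]_s (f i s)%:E.
Proof.
elim: m f => [|m IH] f mf f0 /=; first by rewrite !big_ord0.
rewrite [RHS]big_ord_recl -IH//.
have mP : rV_measurable (fun y : 'rV[R]_m => (\prod_(i < m) f (lift ord0 i) (y ord0 i))%:E).
  move=> d' T' h c mh mc; apply/measurable_EFinP.
  apply: measurable_prod => i _; exact: (measurableT_comp (mf (lift ord0 i)) (mc i)).
have P0 (y : 'rV[R]_m) : 0 <= (\prod_(i < m) f (lift ord0 i) (y ord0 i))%:E.
  by rewrite lee_fin; apply: prodr_ge0.
rewrite -ge0_integralZr//.
- apply: eq_integral => s _.
  rewrite -intRnZl ?lee_fin//; congr intRn; apply/funext => y.
  rewrite big_ord_recl EFinM row_mx1_ord0.
  by under eq_bigr do rewrite row_mx1_lift.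
- by apply/measurable_EFinP; exact: mf.
- by move=> s _; rewrite lee_fin.
- exact: intRn_ge0.
Qed.

End parametric.

(** * The Bessel kernel *)

Section kernel.
Variable R : realType.
Local Open Scope ereal_scope.
Notation leb := (@lebesgue_measure R).
Notation MR := (measurableTypeR R).

(** The pushforward under the reflection agrees with Lebesgue measure on half-open intervals, and
    these determine it. *)
Lemma ge0_integral_reflect (f : MR -> \bar R) (a : R) : measurable_fun setT f ->
  (forall x, 0 <= f x) -> \int[leb]_y f (a - y)%R = \int[leb]_y f y.
Proof.
move=> mf f0; pose phi : MR -> MR := fun y => (a - y)%R.
have mphi : measurable_fun setT phi by apply: measurable_funB.
pose phim : {mfun MR >-> MR} := HB.pack phi (isMeasurableFun.Build _ _ _ _ _ mphi).
transitivity (\int[pushforward leb phim]_y f y).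
  by rewrite ge0_integral_pushforward// preimage_setT.
apply: eq_measure_integral => A mA _; apply/esym.
apply: (lebesgue_measure_unique (mu := pushforward leb phim)) => // X /ocitvP[->|[[x y]/= xy ->]].
  by rewrite !measure0.
rewrite /pushforward/=.
have -> : phi @^-1` `]x, y] = `[(a - y)%R, (a - x)%R[%classic.
  apply/seteqP; split => z /=; rewrite !in_itv/= /phi => /andP[A1 A2]; apply/andP; split; lra.
rewrite !lebesgue_measure_itv/= !lte_fin xy ifT; last by lra.
by rewrite -!EFinB; congr EFin; ring.
Qed.

(** Density of the random time in the mixture, extended by zero so that all integrals run over the
    whole line. *)
Definition expdens : R -> R := (fun s => expR (- s)) \_ `]0%R, +oo[.

(** The heat kernel of the line at time [s], the normal density of variance [2 s]. *)
Definition heat1 (s z : R) : R :=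
  ((4 * pi * s) `^ (- 2^-1) * expR (- z ^+ 2 / (4 * s)))%R.

(** Kept in [\bar R]: for [n >= 2] it is infinite at [z = 0], where [Bker] has the default value
    0. *)
Definition bessel n (z : 'rV[R]_n) : \bar R :=
  \int[leb]_s (expdens s * \prod_(i < n) heat1 s (z ord0 i))%:E.

Lemma measurable_invr d (T : measurableType d) (f : T -> MR) : measurable_fun setT f ->
  measurable_fun setT ((fun x => (f x)^-1%R) : T -> MR).
Proof.
move=> mf.
(* [powR] is measurable, and squaring makes its base nonnegative; at a zero of [f] both sides
   vanish. *)
have -> : (fun x => (f x)^-1%R) = (fun x => f x * (f x ^+ 2) `^ (-1))%R.
  apply/funext => x; rewrite powR_inv1 ?sqr_ge0//.
  by have [->|fx0] := eqVneq (f x) 0%R; [rewrite invr0 mul0r|field].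
apply: measurable_funM => //.
apply: (measurableT_comp (measurable_powR (-1))).
exact: measurable_funX.
Qed.

Lemma expdens_ge0 s : (0 <= expdens s)%R.
Proof. by apply: restrict_ge0 => x _; exact: expR_ge0. Qed.

Lemma expdensE s : expdens s = if (0 < s)%R then expR (- s) else 0%R.
Proof. by rewrite /expdens patchE mem_setE in_itv/= andbT. Qed.

Lemma measurable_expdens : measurable_fun setT (expdens : MR -> MR).
Proof.
apply/(measurable_restrictT _ _).1 => //; apply: measurable_funTS.
by apply: measurableT_comp => //; exact: measurable_expR.
Qed.

Lemma heat1_ge0 s z : (0 <= heat1 s z)%R.
Proof. by rewrite mulr_ge0 ?powR_ge0 ?expR_ge0. Qed.

Lemma heat1N s z : heat1 s (- z) = heat1 s z.
Proof. by rewrite /heat1 sqrrN. Qed.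

Lemma measurable_heat1 d (T : measurableType d) (f g : T -> MR) :
  measurable_fun setT f -> measurable_fun setT g ->
  measurable_fun setT ((fun x => heat1 (f x) (g x)) : T -> MR).
Proof.
move=> mf mg; apply: measurable_funM.
  apply: (measurableT_comp (measurable_powR _)).
  exact: measurable_funM.
apply: (measurableT_comp (@measurable_expR R)); apply: measurable_funM.
  by apply: measurableT_comp => //; exact: measurable_funX.
by apply: measurable_invr; exact: measurable_funM.
Qed.

Lemma integral_heat1 s x : (0 < s)%R -> \int[leb]_y (heat1 s (x - y))%:E = 1.
Proof.
move=> s0; rewrite -[RHS](integral_normal_pdf x (Num.sqrt (2 * s))).
have s20 : Num.sqrt (2 * s) != 0%R by rewrite gt_eqF// sqrtr_gt0; lra.
apply: eq_integral => y _; rewrite normal_pdfE//; congr EFin.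
rewrite /heat1 /normal_peak /normal_fun sqr_sqrtr; last by lra.
congr (_ * expR _)%R.
  rewrite powRN powR12_sqrt; last by rewrite !mulr_ge0// ?pi_ge0// ltW.
  by congr (Num.sqrt _)^-1%R; ring.
have -> : (2 * s *+ 2 = 4 * s)%R by ring.
by congr (_ / _)%R; ring.
Qed.

Lemma integral_heat10 s : (0 < s)%R -> \int[leb]_y (heat1 s y)%:E = 1.
Proof.
move=> s0; rewrite -[RHS](integral_heat1 0 s0).
by apply: eq_integral => y _; rewrite sub0r heat1N.
Qed.

Lemma integral_expRN (r : R) : (0 < r)%R ->
  \int[leb]_(s in `]0%R, +oo[) (expR (- r * s))%:E = (r^-1)%:E.
Proof.
move=> r0; have := integral_exponential_pdf r0.
have -> : (fun x => (exponential_pdf r x)%:E) =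
    (fun x => (r * expR (- r * x))%:E) \_ `[0%R, +oo[.
  by apply/funext => x; rewrite /exponential_pdf !patchE; case: ifPn.
have me : measurable_fun setT ((fun x => (expR (- r * x))%:E) : MR -> \bar R).
  apply/measurable_EFinP; apply: (measurableT_comp (@measurable_expR R)).
  exact: measurable_funM.
rewrite -integral_mkcond => H.
rewrite integral_itv_obnd_cbnd; last exact: measurable_funTS.
have : r^-1%:E * \int[leb]_(x in `[0%R, +oo[) (r * expR (- r * x))%:E = r^-1%:E.
  by rewrite H mule1.
rewrite -ge0_integralZl//.
- move=> <-; apply: eq_integral => s _.
  by rewrite -EFinM mulrA mulVf ?mul1r// gt_eqF.
- apply: measurable_funTS; under eq_fun do rewrite EFinM.
  exact: measurable_funeM.
- by move=> x _; rewrite lee_fin mulr_ge0 ?expR_ge0// ltW.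
- by rewrite lee_fin invr_ge0 ltW.
Qed.

Lemma integral_expdens : \int[leb]_s (expdens s)%:E = 1.
Proof.
have := integral_expRN (@ltr01 R); rewrite invr1 integral_mkcond => <-.
by apply: eq_integral => s _; rewrite /expdens !patchE mulN1r; case: ifPn.
Qed.

(** The Gaussian factorizes over the coordinates. *)
Lemma BkerE n (z : 'rV[R]_n) : Bker z = fine (bessel z).
Proof.
rewrite /Bker integral_mkcond; congr fine; apply: eq_integral => s _.
rewrite expdensE patchE mem_setE in_itv/= andbT; case: ifPn => s0; last by rewrite mul0r.
congr EFin; rewrite -mulrA; congr (_ * _)%R.
rewrite big_split/= prodr_const card_ord; congr (_ * _)%R.
  rewrite -powR_mulrn ?powR_ge0// -powRrM; congr powR; ring.
rewrite -expR_sum; congr expR; rewrite -mulr_suml; congr (_ / _)%R.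
by rewrite sumrN; congr (- _)%R; rewrite sqr_sqrtr// sumr_ge0// => i _; exact: sqr_ge0.
Qed.

Lemma bessel_ge0 n (z : 'rV[R]_n) : 0 <= bessel z.
Proof.
apply: integral_ge0 => s _; rewrite lee_fin mulr_ge0 ?expdens_ge0//.
by apply: prodr_ge0 => i _; exact: heat1_ge0.
Qed.

Lemma Bker_ge0 n (z : 'rV[R]_n) : (0 <= Bker z)%R.
Proof. by rewrite BkerE fine_ge0// bessel_ge0. Qed.

Lemma Bker_le_bessel n (z : 'rV[R]_n) : (Bker z)%:E <= bessel z.
Proof.
rewrite BkerE; have := bessel_ge0 z; case: (bessel z) => //= *.
Qed.

Lemma measurable_bessel d (T : measurableType d) n (c : T -> 'rV[R]_n) :
  (forall i, measurable_fun setT ((fun t => c t ord0 i) : T -> MR)) ->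
  measurable_fun setT ((fun t => bessel (c t)) : T -> \bar R).
Proof.
move=> mc.
apply: (@measurable_fun_fubini_tonelli_F _ _ _ MR _ leb
  (fun ts : T * MR => (expdens ts.2 * \prod_(i < n) heat1 ts.2 (c ts.1 ord0 i))%:E)).
  apply/measurable_EFinP; apply: measurable_funM.
    exact: (measurableT_comp measurable_expdens measurable_snd).
  apply: measurable_prod => i _; apply: measurable_heat1; first exact: measurable_snd.
  exact: (measurableT_comp (mc i) measurable_fst).
move=> ts; rewrite lee_fin mulr_ge0 ?expdens_ge0//.
by apply: prodr_ge0 => i _; exact: heat1_ge0.
Qed.

(* Integral against the one-dimensional kernel, the marginal of [bessel] in each coordinate. *)
Definition bessel1 (h : R -> R) : \bar R :=
  \int[leb]_s ((expdens s)%:E * \int[leb]_z (heat1 s z * h z)%:E).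

Lemma bessel1_ge0 h : (forall z, 0 <= h z)%R -> 0 <= bessel1 h.
Proof.
move=> h0; apply: integral_ge0 => s _; apply: mule_ge0; first by rewrite lee_fin expdens_ge0.
by apply: integral_ge0 => z _; rewrite lee_fin mulr_ge0 ?heat1_ge0.
Qed.

Lemma le_bessel1 h1 h2 : (forall z, h1 z <= h2 z)%R -> bessel1 h1 <= bessel1 h2.
Proof.
move=> h12; apply: le_integral_pointwise => s _; apply: lee_wpmul2l; first by rewrite lee_fin expdens_ge0.
by apply: le_integral_pointwise => z _; rewrite lee_fin ler_wpM2l ?heat1_ge0.
Qed.

Lemma measurable_heat1M s (h : MR -> MR) : measurable_fun setT h ->
  measurable_fun setT ((fun z => (heat1 s z * h z)%:E) : MR -> \bar R).
Proof.
move=> mh; apply/measurable_EFinP; apply: measurable_funM => //.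
exact: measurable_heat1.
Qed.

Lemma measurable_heat_conv (h : MR -> MR) : measurable_fun setT h -> (forall z, 0 <= h z)%R ->
  measurable_fun setT ((fun s => \int[leb]_z (heat1 s z * h z)%:E) : MR -> \bar R).
Proof.
move=> mh h0.
apply: (@measurable_fun_fubini_tonelli_F _ _ MR MR _ leb
  (fun ts : MR * MR => (heat1 ts.1 ts.2 * h ts.2)%:E)).
  apply/measurable_EFinP; apply: measurable_funM.
    by apply: measurable_heat1; [exact: measurable_fst|exact: measurable_snd].
  exact: (measurableT_comp mh measurable_snd).
by move=> ts; rewrite lee_fin mulr_ge0 ?heat1_ge0.
Qed.

Lemma bessel1D (h1 h2 : MR -> MR) : measurable_fun setT h1 -> measurable_fun setT h2 ->
  (forall z, 0 <= h1 z)%R -> (forall z, 0 <= h2 z)%R ->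
  bessel1 (fun z => h1 z + h2 z)%R = bessel1 h1 + bessel1 h2.
Proof.
move=> m1 m2 p1 p2.
have I0 (h : MR -> MR) s : (forall z, 0 <= h z)%R -> 0 <= \int[leb]_z (heat1 s z * h z)%:E.
  by move=> h0; apply: integral_ge0 => z _; rewrite lee_fin mulr_ge0 ?heat1_ge0.
have J (h : MR -> MR) : measurable_fun setT h -> (forall z, 0 <= h z)%R ->
    measurable_fun setT ((fun s => (expdens s)%:E * \int[leb]_z (heat1 s z * h z)%:E) : MR -> \bar R).
  move=> mh h0; apply: emeasurable_funM; last exact: measurable_heat_conv.
  by apply/measurable_EFinP; exact: measurable_expdens.
rewrite /bessel1 -ge0_integralD//; try exact: J; last 2 first.
- by move=> s _; rewrite mule_ge0// ?lee_fin ?expdens_ge0// I0.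
- by move=> s _; rewrite mule_ge0// ?lee_fin ?expdens_ge0// I0.
apply: eq_integral => s _; rewrite -ge0_muleDr ?I0//; congr (_ * _).
rewrite -ge0_integralD//; last 4 first.
- by move=> z _; rewrite lee_fin mulr_ge0 ?heat1_ge0.
- exact: measurable_heat1M.
- by move=> z _; rewrite lee_fin mulr_ge0 ?heat1_ge0.
- exact: measurable_heat1M.
by apply: eq_integral => z _; rewrite -EFinD mulrDr.
Qed.

Lemma bessel1Zl (c : R) (h : MR -> MR) : measurable_fun setT h -> (0 <= c)%R ->
  (forall z, 0 <= h z)%R -> bessel1 (fun z => c * h z)%R = c%:E * bessel1 h.
Proof.
move=> mh c0 h0; rewrite /bessel1 -ge0_integralZl//; last 2 first.
- apply: emeasurable_funM; last exact: measurable_heat_conv.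
  by apply/measurable_EFinP; exact: measurable_expdens.
- move=> s _; rewrite mule_ge0// ?lee_fin ?expdens_ge0//.
  by apply: integral_ge0 => z _; rewrite lee_fin mulr_ge0 ?heat1_ge0.
apply: eq_integral => s _; rewrite muleCA; congr (_ * _).
rewrite -ge0_integralZl//; last 2 first.
- exact: measurable_heat1M.
- by move=> z _; rewrite lee_fin mulr_ge0 ?heat1_ge0.
by apply: eq_integral => z _; rewrite -EFinM mulrCA.
Qed.

Lemma bessel1_cst1 : bessel1 (cst 1%R) = 1.
Proof.
rewrite /bessel1 -[RHS]integral_expdens; apply: eq_integral => s _.
rewrite expdensE; case: ifPn => s0; last by rewrite mul0e.
under eq_integral do rewrite /= mulr1.
by rewrite integral_heat10// mule1.
Qed.

Lemma bessel1_cst (c : R) : (0 <= c)%R -> bessel1 (fun=> c) = c%:E.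
Proof.
move=> c0; transitivity (bessel1 (fun z => c * cst 1%R z)%R).
  by congr bessel1; apply: funext => z; rewrite /= mulr1.
by rewrite bessel1Zl// bessel1_cst1 mule1.
Qed.

Lemma bessel1_reflect (h : MR -> MR) : measurable_fun setT h -> (forall z, 0 <= h z)%R ->
  bessel1 (fun z => h (- z)%R) = bessel1 h.
Proof.
move=> mh h0; rewrite /bessel1; apply: eq_integral => s _; congr (_ * _).
rewrite -(@ge0_integral_reflect (fun z => (heat1 s z * h z)%:E) 0).
- by apply: eq_integral => z _; rewrite sub0r heat1N.
- exact: measurable_heat1M.
- by move=> z; rewrite lee_fin mulr_ge0 ?heat1_ge0.
Qed.

(** After Tonelli the Gaussian factors in the coordinates other than [i] integrate to 1, which
    leaves the marginal. *)
Lemma intRn_bessel_coord n (x : 'rV[R]_n) (i : 'I_n) (f : MR -> MR) :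
  measurable_fun setT f -> (forall z, 0 <= f z)%R ->
  intRn (fun y => bessel (x - y) * (f (y ord0 i))%:E) = bessel1 (fun z => f (x ord0 i + z)%R).
Proof.
move=> mf f0.
pose F (s : MR) (y : 'rV[R]_n) : \bar R :=
  (expdens s * \prod_(j < n) heat1 s ((x - y) ord0 j) * f (y ord0 i))%:E.
have mF : pmeasurable F.
  move=> d' T' h c mh mc; apply/measurable_EFinP; apply: measurable_funM.
    apply: measurable_funM; first exact: (measurableT_comp measurable_expdens mh).
    apply: measurable_prod => j _; apply: measurable_heat1 => //.
    have -> : (fun t : T' => (x - c t)%R ord0 j) = (fun t => x ord0 j - c t ord0 j)%R.
      by apply: funext => t; rewrite !mxE.
    by apply: measurable_funB; [exact: measurable_cst|exact: mc].
  exact: (measurableT_comp mf (mc i)).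
have P0 s y : (0 <= \prod_(j < n) heat1 s ((x - y) ord0 j))%R.
  by apply: prodr_ge0 => j _; exact: heat1_ge0.
have F0 s y : 0 <= F s y by rewrite lee_fin !mulr_ge0 ?expdens_ge0.
transitivity (intRn (fun y => \int[leb]_s F s y)).
  congr intRn; apply/funext => y; rewrite /bessel -ge0_integralZr//.
  - apply/measurable_EFinP; apply: measurable_funM; first exact: measurable_expdens.
    by apply: measurable_prod => j _; exact: measurable_heat1.
  - by move=> s _; rewrite lee_fin mulr_ge0 ?expdens_ge0.
  - by rewrite lee_fin.
rewrite (intRn_swap mF F0); apply: eq_integral => s _.
(* The factors have mass 1 only for [s > 0]; elsewhere the density of the time vanishes. *)
rewrite /F expdensE; case: ifPn => s0; last first.
  rewrite mul0e; under eq_fun do rewrite !mul0r.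
  apply/eqP; rewrite eq_le intRn_ge0// andbT.
  have -> : (fun _ : 'rV[R]_n => 0) = (fun y => 0 * (cst 0 y : \bar R)).
    by apply/funext => y; rewrite mul0e.
  by rewrite intRnZl ?mul0e// => d' T' h c _ _; exact: measurable_cst.
pose g (j : 'I_n) (z : R) : R := (heat1 s (x ord0 j - z) * if j == i then f z else 1)%R.
have mg j : measurable_fun setT (g j : MR -> MR).
  apply: measurable_funM; first by apply: measurable_heat1 => //; exact: measurable_funB.
  by case: eqP.
have g0 j z : (0 <= g j z)%R by rewrite mulr_ge0 ?heat1_ge0//; case: eqP.
transitivity (intRn (fun y : 'rV[R]_n => (expR (- s))%:E * (\prod_(j < n) g j (y ord0 j))%:E)).
  congr intRn; apply/funext => y; rewrite -EFinM -mulrA.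
  congr EFin; congr (_ * _)%R; rewrite [RHS]big_split/=; congr (_ * _)%R.
    by apply: eq_bigr => j _; rewrite !mxE.
  by rewrite -big_mkcond/= big_pred1_eq.
rewrite intRnZl ?lee_fin ?expR_ge0//; last 2 first.
- move=> d' T' h c mh mc; apply/measurable_EFinP.
  by apply: measurable_prod => j _; exact: (measurableT_comp (mg j) (mc j)).
- by move=> y; rewrite lee_fin; apply: prodr_ge0.
congr (_ * _); rewrite intRn_prod// (bigD1 i)//= big1 ?mule1; last first.
  move=> j /negPf ji; rewrite /g ji.
  by under eq_integral do rewrite mulr1; exact: integral_heat1.
rewrite /g eqxx.
(* Reflect about [x_i], then about 0; evenness of [heat1] absorbs the sign. *)
transitivity (\int[leb]_y (heat1 s y * f (x ord0 i - y)%R)%:E).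
  rewrite -(@ge0_integral_reflect (fun z => (heat1 s (x ord0 i - z) * f z)%:E) (x ord0 i)).
  - by apply: eq_integral => z _; rewrite opprB addrC subrK.
  - apply/measurable_EFinP; apply: measurable_funM => //.
    by apply: measurable_heat1 => //; exact: measurable_funB.
  - by move=> z; rewrite lee_fin mulr_ge0 ?heat1_ge0.
rewrite -(@ge0_integral_reflect (fun z => (heat1 s z * f (x ord0 i - z)%R)%:E) 0).
- by apply: eq_integral => z _; rewrite sub0r heat1N opprK.
- apply/measurable_EFinP; apply: measurable_funM; first exact: measurable_heat1.
  by apply: (measurableT_comp mf); exact: measurable_funB.
- by move=> z; rewrite lee_fin mulr_ge0 ?heat1_ge0.
Qed.

End kernel.

(** * Moments of the kernel and expansion of even powers *)

Section moments.
Variable R : realType.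
Local Open Scope ereal_scope.
Notation leb := (@lebesgue_measure R).
Notation MR := (measurableTypeR R).

Lemma exprn_le_fact_expR (x : R) j : (0 <= x)%R -> (x ^+ j <= j`!%:R * expR x)%R.
Proof.
move=> x0; case: j => [|j]; first by rewrite expr0 mul1r -expR0 ler_expR.
have := expR_ge1Dxn j x0; have f0 : (0 < j.+1`!%:R :> R)%R by rewrite ltr0n fact_gt0.
move=> H; rewrite mulrC -ler_pdivrMr//; apply: le_trans H; lra.
Qed.

(** Half of the Gaussian exponent absorbs [z^(2j)] and leaves the heat kernel at time [2 s]; half of
    [e^(-s)] absorbs the resulting [s^j]. *)
Lemma bessel1_moment j : bessel1 (fun z => z ^+ (2 * j))%R <= (4 * 16 ^+ j * j`!%:R ^+ 2)%:E :> \bar R.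
Proof.
pose c : R := (j`!%:R * 8 ^+ j)%R.
have c0 : (0 <= c)%R by rewrite mulr_ge0 ?exprn_ge0.
have hb (s z : R) : (0 < s)%R ->
    (heat1 s z * z ^+ (2 * j) <= 2 * c * s ^+ j * heat1 (2 * s) z)%R.
  move=> s0; rewrite /heat1.
  (* Doubling the time changes the normalization by [sqrt 2], here bounded by 2. *)
  have p1 : ((4 * pi * s) `^ (- 2^-1) <= 2 * (4 * pi * (2 * s)) `^ (- 2^-1))%R.
    have -> : (4 * pi * (2 * s) = 2 * (4 * pi * s) :> R)%R by ring.
    have ps0 : (0 <= 4 * pi * s)%R by rewrite !mulr_ge0 ?pi_ge0 ?ltW.
    rewrite (@powRM _ 2 (4 * pi * s)%R)// mulrA ler_peMl ?powR_ge0//.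
    rewrite powRN powR12_sqrt// ler_pdivlMr ?mul1r; last by rewrite sqrtr_gt0.
    by rewrite -[leRHS]ger0_norm// -sqrtr_sqr ler_sqrt ?sqr_ge0//; nra.
  pose w : R := (z ^+ 2 / (8 * s))%R.
  have w0 : (0 <= w)%R by rewrite divr_ge0 ?sqr_ge0//; lra.
  have sn0 : s != 0%R by rewrite gt_eqF.
  have p2 : (expR (- z ^+ 2 / (4 * s)) * z ^+ (2 * j) <=
      c * s ^+ j * expR (- z ^+ 2 / (4 * (2 * s))))%R.
    have -> : (- z ^+ 2 / (4 * s) = - w - w)%R by rewrite /w; field.
    have -> : (- z ^+ 2 / (4 * (2 * s)) = - w)%R by rewrite /w; field.
    have -> : (z ^+ (2 * j) = (8 * s) ^+ j * w ^+ j)%R.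
      by rewrite exprM -exprMn; congr (_ ^+ _)%R; rewrite /w; field.
    rewrite expRD [leLHS]mulrA -mulrA.
    rewrite [leLHS](_ : _ = (8 * s) ^+ j * expR (- w) * (expR (- w) * w ^+ j))%R; last by ring.
    rewrite [leRHS](_ : _ = (8 * s) ^+ j * expR (- w) * j`!%:R)%R; last by rewrite /c exprMn; ring.
    have e8 : (0 <= (8 * s) ^+ j * expR (- w))%R by rewrite mulr_ge0 ?expR_ge0// exprn_ge0//; lra.
    rewrite ler_wpM2l//.
    by rewrite expRN mulrC ler_pdivrMr ?expR_gt0// exprn_le_fact_expR.
  rewrite -mulrA.
  rewrite [leRHS](_ : _ = (2 * (4 * pi * (2 * s)) `^ (- 2^-1)) *
    (c * s ^+ j * expR (- z ^+ 2 / (4 * (2 * s)))))%R; last by ring.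
  apply: ler_pM => //; first exact: powR_ge0.
  by rewrite mulr_ge0 ?expR_ge0// exprM exprn_ge0// sqr_ge0.
pose C : R := (2 * c * 2 ^+ j * j`!%:R)%R.
have C0 : (0 <= C)%R by rewrite !mulr_ge0// exprn_ge0.
(* The factor [2^-1^-1] is the integral of [e^(-s/2)], the half of the time density that is kept. *)
have -> : (4 * 16 ^+ j * j`!%:R ^+ 2)%:E = C%:E * (2^-1^-1)%:E :> \bar R.
  by rewrite -EFinM /C /c invrK (_ : 16 = 8 * 2 :> R)%R ?exprMn; [congr EFin; ring|ring].
have me : measurable_fun setT ((fun s => (expR (- 2^-1 * s))%:E) : MR -> \bar R).
  by apply/measurable_EFinP; apply: (measurableT_comp (@measurable_expR R)); exact: measurable_funM.
rewrite -integral_expRN; last by lra.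
rewrite -ge0_integralZl//; last exact: measurable_funTS.
rewrite integral_mkcond; apply: le_integral_pointwise => s _.
rewrite expdensE patchE mem_setE in_itv/= andbT; case: ifPn => s0; last by rewrite mul0e.
apply: (@le_trans _ _ ((expR (- s))%:E * (2 * c * s ^+ j)%:E)).
  apply: lee_wpmul2l; first by rewrite lee_fin expR_ge0.
  rewrite -[leRHS]mule1 -(@integral_heat10 _ (2 * s)%R); last by lra.
  rewrite -ge0_integralZl//; last 3 first.
  - by apply/measurable_EFinP; exact: measurable_heat1.
  - by move=> z _; rewrite lee_fin heat1_ge0.
  - by rewrite lee_fin !mulr_ge0 ?exprn_ge0// ltW.
  by apply: le_integral_pointwise => z _; rewrite -EFinM lee_fin hb.
rewrite -!EFinM lee_fin /C.
have hs0 : (0 <= 2^-1 * s)%R by lra.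
have := exprn_le_fact_expR j hs0; rewrite exprMn => H.
have -> : (expR (- s) = expR (- 2^-1 * s) * expR (- 2^-1 * s) :> R)%R.
  by rewrite -expRD; congr expR; lra.
have E1 : (expR (2^-1 * s) * expR (- 2^-1 * s) = 1 :> R)%R.
  by rewrite mulNr -expRD subrr expR0.
have -> : (s ^+ j = 2 ^+ j * (2^-1 ^+ j * s ^+ j) :> R)%R.
  by rewrite mulrA -exprMn divff// expr1n mul1r.
rewrite [leLHS](_ : _ = (2 * c * 2 ^+ j * expR (- 2^-1 * s)) * (expR (- 2^-1 * s) * (2^-1 ^+ j * s ^+ j)))%R; last by ring.
rewrite [leRHS](_ : _ = (2 * c * 2 ^+ j * expR (- 2^-1 * s)) * j`!%:R)%R; last by ring.
rewrite ler_wpM2l ?mulr_ge0 ?exprn_ge0 ?expR_ge0//.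
apply: (@le_trans _ _ (expR (- 2^-1 * s) * (j`!%:R * expR (2^-1 * s)))%R).
  by rewrite ler_wpM2l ?expR_ge0.
by rewrite mulrCA (mulrC (expR (- _ * _))) E1 mulr1.
Qed.

(** The linear term is kept exactly because it cancels under [z -> -z]; the remainder has two powers
    of [x] less than the main term, which is the origin of the factor [1/T]. *)
Lemma expr2nD_le (x z : R) N :
  ((x + z) ^+ (2 * N.+1) <= x ^+ (2 * N.+1) + (2 * N.+1)%:R * x ^+ (2 * N.+1).-1 * z
     + 16 ^+ N.+1 * N.+1`!%:R * (z ^+ 2 * (x ^+ 2 + z ^+ 2) ^+ N))%R.
Proof.
elim: N => [|N IH].
  rewrite mulr1 !expr1 expr0 /= !mulr1.
  rewrite muln1.
  have := sqr_ge0 z; nra.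
pose r := (x ^+ 2 + z ^+ 2)%R.
have r0 : (0 <= r)%R by rewrite addr_ge0// sqr_ge0.
set A := (16 ^+ N.+1 * N.+1`!%:R : R)%R in IH *.
have A1 : (1 <= A)%R.
  rewrite -[leLHS]mulr1 ler_pM ?exprn_ege1//; first by lra.
  by rewrite ler1n fact_gt0.
have xr : (`|x| ^+ 2 <= r)%R by rewrite real_normK ?num_real// lerDl sqr_ge0.
have zr : (`|z| ^+ 2 <= r)%R by rewrite real_normK ?num_real// lerDr sqr_ge0.
have -> : ((2 * N.+2) = (2 * N.+1).+2)%N by rewrite !mulnS.
set M := (2 * N.+1)%N in IH *.
have M0 : (0 < M)%N by [].
have AM : (16 ^+ N.+2 * N.+2`!%:R = 16 * N.+2%:R * A)%R by rewrite exprS factS natrM /A; ring.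
rewrite AM.
have h1 : (x ^+ M <= r ^+ N.+1)%R.
  rewrite /M exprM lerXn2r// ?nnegrE ?sqr_ge0//.
  by move: xr; rewrite real_normK ?num_real.
have h2 : (x ^+ M.-1 * z <= r ^+ N.+1)%R.
  apply: (le_trans (ler_norm _)); rewrite normrM normrX.
  have -> : M.-1 = (2 * N).+1 by rewrite /M mulnS.
  rewrite exprS exprS mulrAC ler_pM ?mulr_ge0 ?exprn_ge0//.
    have := sqr_ge0 (`|x| - `|z|)%R; rewrite sqrrB => H.
    have := xr; have := zr; nra.
  by rewrite exprM lerXn2r// ?nnegrE ?sqr_ge0.
have h3 : ((x + z) ^+ 2 <= 2 * r)%R by rewrite /r; have := sqr_ge0 (x - z)%R; nra.
have rN : (0 <= r ^+ N)%R by rewrite exprn_ge0.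
have MN : (M%:R = 2 * N.+1%:R :> R)%R by rewrite /M natrM.
have N2 : (N.+2%:R = N.+1%:R + 1 :> R)%R by rewrite -natr1.
have N1 : (1 <= N.+1%:R :> R)%R by rewrite ler1n.
rewrite -addn2 exprD.
have s0 : (0 <= (x + z) ^+ 2)%R by rewrite sqr_ge0.
apply: (le_trans (ler_wpM2r s0 IH)).
have xM : (x ^+ M = x ^+ M.-1 * x)%R by rewrite -exprSr prednK.
rewrite addn2 /= [(x ^+ M.+2)%R]exprS [(x ^+ M.+1)%R]exprS.
have M2 : (M.+2%:R = M%:R + 2 :> R)%R by rewrite -addn2 natrD.
rewrite M2.
(* Only terms of order at least two in [z] remain; each is at most a multiple of [z^2 r^(N+1)]. *)
rewrite -subr_ge0 [leRHS](_ : _ = z ^+ 2 * (16 * N.+2%:R * A * r ^+ N.+1 - A * r ^+ N * (x + z) ^+ 2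
   - x ^+ M - 2 * M%:R * x ^+ M - M%:R * (x ^+ M.-1 * z)))%R; last first.
  by rewrite -/r xM; ring.
rewrite mulr_ge0 ?sqr_ge0//.
have h4 : (A * r ^+ N * (x + z) ^+ 2 <= 2 * A * r ^+ N.+1)%R.
  rewrite [leRHS](_ : _ = A * r ^+ N * (2 * r))%R; last by rewrite (exprS r N); ring.
  by rewrite ler_wpM2l// mulr_ge0//; lra.
have rN1 : (0 <= r ^+ N.+1)%R by rewrite exprn_ge0.
have h5 : (N.+2%:R * r ^+ N.+1 <= N.+2%:R * A * r ^+ N.+1)%R.
  by rewrite -mulrA ler_wpM2l// ler_peMl.
have h6 : (A * r ^+ N.+1 <= N.+2%:R * A * r ^+ N.+1)%R.
  by rewrite -mulrA ler_peMl ?mulr_ge0 ?ler1n//; lra.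
have h7 : (2 * M%:R * x ^+ M <= 4 * N.+2%:R * r ^+ N.+1)%R.
  by rewrite ler_pM// ?mulr_ge0//; [rewrite /M exprM exprn_ge0// sqr_ge0|lra].
have h8 : (M%:R * (x ^+ M.-1 * z) <= 2 * N.+2%:R * r ^+ N.+1)%R.
  apply: (@le_trans _ _ (M%:R * r ^+ N.+1)%R); first by rewrite ler_wpM2l.
  by rewrite ler_wpM2r//; lra.
have h9 : (r ^+ N.+1 <= N.+2%:R * r ^+ N.+1)%R by rewrite ler_peMl// ler1n.
lra.
Qed.

End moments.

(** * The marginal kernel on even polynomials; elementary bounds for the cosine *)

Section growth.
Variable R : realType.
Local Open Scope ereal_scope.
Notation leb := (@lebesgue_measure R).
Notation MR := (measurableTypeR R).

(** The marginal kernel is even, so only the even part of [h] counts. *)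
Lemma bessel1_sym_le (h g : MR -> MR) (c : R) :
  measurable_fun setT h -> (forall z, 0 <= h z)%R ->
  (forall z, h z + h (- z) <= 2 * g z)%R -> bessel1 g <= c%:E -> bessel1 h <= c%:E.
Proof.
move=> mh h0 hg gc.
have mhN : measurable_fun setT ((fun z => h (- z)%R) : MR -> MR).
  by apply: (measurableT_comp mh); exact: oppr_measurable.
have mh2 : measurable_fun setT ((fun z => h z + h (- z))%R : MR -> MR).
  exact: measurable_funD.
have -> : bessel1 h = (2^-1)%:E * (bessel1 h + bessel1 (fun z => h (- z)%R)).
  rewrite bessel1_reflect// ge0_muleDr ?bessel1_ge0// -ge0_muleDl ?lee_fin//.
  by rewrite -EFinD (_ : 2^-1 + 2^-1 = 1)%R ?mul1e//; lra.
have hN0 z : (0 <= h (- z))%R by [].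
have hh0 z : (0 <= h z + h (- z))%R by rewrite addr_ge0.
have hf0 : (0 <= 2^-1 :> R)%R by [].
rewrite -(bessel1D mh mhN h0 hN0) -(bessel1Zl mh2 hf0 hh0).
apply: le_trans gc; apply: le_bessel1 => z; have := hg z; lra.
Qed.

Lemma bessel1_evenpoly N : (0 < N)%N -> exists2 C : R, (0 < C)%R & forall T x : R, (1 <= T)%R ->
  bessel1 (fun z => T ^+ N + (x + z) ^+ (2 * N))%R <= ((1 + C / T) * (T ^+ N + x ^+ (2 * N)))%:E.
Proof.
case: N => // N _.
pose A : R := (16 ^+ N.+1 * N.+1`!%:R)%R.
pose m : R := (4 * 16 ^+ N.+1 * N.+1`!%:R ^+ 2)%R.
have A0 : (0 < A)%R by rewrite mulr_gt0 ?exprn_gt0// ltr0n fact_gt0.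
have m0 : (0 < m)%R by rewrite !mulr_gt0 ?exprn_gt0// ltr0n fact_gt0.
(* [A] comes from the remainder of [expr2nD_le], [2 ^+ N.+1] from [(1 + z^2)^(N+1)], and [m] from
   the moment of order [2(N+1)]. *)
exists (A * 2 ^+ N.+1 * (1 + m))%R; first by rewrite !mulr_gt0 ?exprn_gt0//; lra.
move=> T x T1.
have T0 : (0 < T)%R by lra.
set q := (T ^+ N.+1 + x ^+ (2 * N.+1))%R.
have x20 : (0 <= x ^+ 2)%R by rewrite sqr_ge0.
have xN0 : (0 <= x ^+ (2 * N.+1))%R by rewrite exprM exprn_ge0.
have TN0 : (0 <= T ^+ N.+1)%R by rewrite exprn_ge0// ltW.
have q0 : (0 <= q)%R by rewrite addr_ge0.
pose g (z : R) : R := (q + A / T * q * (2 ^+ N.+1 * (1 + z ^+ (2 * N.+1))))%R.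
apply: (@bessel1_sym_le _ g).
- apply: measurable_funD => //; apply: measurable_funX; exact: measurable_funD.
- by move=> z; rewrite addr_ge0// exprM exprn_ge0// sqr_ge0.
- move=> z; have := expr2nD_le x z N; have := expr2nD_le x (- z)%R N.
  rewrite !sqrrN -/A mulrN.
  set P := (_ * _ * z)%R; set W := (z ^+ 2 * _)%R => H1 H2.
  have hW : (W <= q / T * (2 ^+ N.+1 * (1 + z ^+ (2 * N.+1))))%R.
    (* With [M = max(x^2, T)], the bounds [M^(N+1) <= q] and [M >= T] give [M^N <= q / T]. *)
    have z20 : (0 <= z ^+ 2)%R by rewrite sqr_ge0.
    pose M : R := Num.max (x ^+ 2)%R T.
    have MT : (T <= M)%R by rewrite le_max lexx orbT.
    have Mx : (x ^+ 2 <= M)%R by rewrite le_max lexx.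
    have M0 : (0 < M)%R by lra.
    have MN : (M ^+ N.+1 <= q)%R.
      rewrite /M /q; case: (leP (x ^+ 2)%R T) => _; first by rewrite lerDl.
      by rewrite -exprM lerDr.
    have h1 : (x ^+ 2 + z ^+ 2 <= M * (1 + z ^+ 2))%R by nra.
    have h2 : (M ^+ N <= q / T)%R.
      rewrite ler_pdivlMr//; apply: le_trans MN; rewrite exprSr ler_wpM2l// exprn_ge0//; lra.
    have h3 : ((1 + z ^+ 2) ^+ N.+1 <= 2 ^+ N.+1 * (1 + z ^+ (2 * N.+1)))%R.
      pose Z : R := Num.max 1%R (z ^+ 2)%R.
      have Z1 : (1 <= Z)%R by rewrite le_max lexx.
      have Zz : (z ^+ 2 <= Z)%R by rewrite le_max lexx orbT.
      apply: (@le_trans _ _ ((2 * Z) ^+ N.+1)%R).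
        by rewrite lerXn2r// ?nnegrE; lra.
      rewrite exprMn ler_wpM2l ?exprn_ge0// /Z exprM.
      case: (leP 1%R (z ^+ 2)%R) => _; first by rewrite lerDr.
      by rewrite expr1n lerDl exprn_ge0.
    apply: (@le_trans _ _ ((1 + z ^+ 2) * (M * (1 + z ^+ 2)) ^+ N)%R).
      apply: ler_pM => //; first by rewrite exprn_ge0// addr_ge0.
        by lra.
      by rewrite lerXn2r// nnegrE; nra.
    rewrite exprMn mulrCA -exprS ler_pM// ?exprn_ge0//; lra.
  have h : (A * W <= A / T * q * (2 ^+ N.+1 * (1 + z ^+ (2 * N.+1))))%R.
    rewrite [leRHS](_ : _ = A * (q / T * (2 ^+ N.+1 * (1 + z ^+ (2 * N.+1)))))%R; last by ring.
    by rewrite ler_wpM2l// ltW.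
  have qE : (T ^+ N.+1 + x ^+ (2 * N.+1) = q)%R by [].
  move: h; rewrite /g; set B := (A / T * q * _)%R => h.
  by clearbody q B P W; lra.
pose k : R := (A / T * q * 2 ^+ N.+1)%R.
have k0 : (0 <= k)%R by rewrite !mulr_ge0 ?exprn_ge0// ?invr_ge0 ltW.
have -> : g = (fun z => (q + k) + k * z ^+ (2 * N.+1))%R.
  by apply: funext => z; rewrite /g /k; ring.
have mX : measurable_fun setT ((fun z => z ^+ (2 * N.+1))%R : MR -> MR).
  exact: measurable_funX.
rewrite (@bessel1D _ (fun=> q + k)%R (fun z => k * z ^+ (2 * N.+1))%R)//; last 3 first.
- exact: measurable_funM.
- by move=> z; rewrite addr_ge0.
- by move=> z; rewrite mulr_ge0// exprM exprn_ge0// sqr_ge0.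
rewrite bessel1_cst ?addr_ge0// bessel1Zl//; last by move=> z; rewrite exprM exprn_ge0// sqr_ge0.
apply: (@le_trans _ _ ((q + k)%:E + k%:E * m%:E)).
  by rewrite leeD2l// lee_wpmul2l ?lee_fin//; exact: bessel1_moment.
rewrite -EFinM -EFinD lee_fin /k; rewrite le_eqVlt; apply/orP; left; apply/eqP; field.
by rewrite gt_eqF.
Qed.

(** Mean value theorem, the derivative being at least [cos 1] on [[0, 1]]. *)
Lemma sin_ge_linear (y : R) : (0 <= y <= 1)%R -> (y * cos 1 <= sin y)%R.
Proof.
move=> /andP[y0 y1]; have [->|yn0] := eqVneq y 0%R; first by rewrite mul0r sin0.
have yp : (0 < y)%R by rewrite lt_neqAle eq_sym yn0.
have [|c] := @MVT R sin cos 0%R y yp (fun x _ => is_derive_sin x).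
  by apply: continuous_subspaceT => x; exact: continuous_sin.
rewrite in_itv/= => /andP[c0 cy]; rewrite sin0 !subr0 => ->.
rewrite mulrC ler_wpM2r//.
have pi2 := @pi_ge2 R.
rewrite leNgt ltr_cos ?in_itv/=; [rewrite -leNgt; lra| |]; apply/andP; split; lra.
Qed.

Lemma one_sub_cos_ge (y : R) : (0 <= y <= 1)%R -> (cos 1 ^+ 2 / 2 * y ^+ 2 <= 1 - cos y)%R.
Proof.
move=> /andP[y0 y1].
have -> : (1 - cos y = 2 * sin (y / 2) ^+ 2)%R.
  have {1}-> : y = (y / 2 *+ 2)%R by rewrite -mulr_natr divfK.
  by rewrite cos_mulr2n; have := cos2Dsin2 (y / 2)%R; lra.
have h : (y / 2 * cos 1 <= sin (y / 2))%R by apply: sin_ge_linear; apply/andP; split; lra.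
have c1 := @cos1_gt0 R.
have h0 : (0 <= y / 2 * cos 1)%R by rewrite mulr_ge0//; lra.
have : ((y / 2 * cos 1) ^+ 2 <= sin (y / 2) ^+ 2)%R by rewrite lerXn2r ?nnegrE//; lra.
by rewrite !exprMn; nra.
Qed.

End growth.

(** * The cosine as an eigenfunction and its spectral gap *)

Section cosine.
Variable R : realType.
Local Open Scope ereal_scope.
Notation leb := (@lebesgue_measure R).
Notation MR := (measurableTypeR R).

(** The integrand is bounded below for [s] in [[1, 2]]. The box avoids 0 so that [1 - cos (k z)] is
    of order [k^2] on it. *)
Lemma bessel1_box_gt0 : exists2 c : R, (0 < c)%R & c%:E <= bessel1 (\1_(`[2^-1%R, 1%R]%classic) : R -> R).
Proof.
(* [b] bounds [heat1 s z] from below there: [4 pi s <= 8 pi] and [z^2 / (4 s) <= 1/4]. *)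
pose b : R := ((8 * pi) `^ (- 2^-1) * expR (- 4^-1))%R.
have b0 : (0 < b)%R by rewrite mulr_gt0 ?expR_gt0// powR_gt0// mulr_gt0// pi_gt0.
exists (expR (- 2) * (b * 2^-1))%R; first by rewrite mulr_gt0 ?expR_gt0// mulr_gt0// invr_gt0.
apply: (@le_trans _ _ (\int[leb]_(s in `[1%R, 2%R]) (expR (- 2) * (b * 2^-1))%:E)).
  rewrite integral_cst//= lebesgue_measure_itv/= lte_fin ltr1n -EFinB.
  by rewrite (_ : 2 - 1 = 1)%R ?mule1//; ring.
rewrite integral_mkcond; apply: le_integral_pointwise => s _; rewrite patchE mem_setE in_itv/=.
have K0 t : 0 <= \int[leb]_z (heat1 t z * \1_(`[2^-1%R, 1%R]%classic) z)%:E.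
  by apply: integral_ge0 => z _; rewrite lee_fin mulr_ge0 ?heat1_ge0.
case: ifPn => [/andP[s1 s2]|_]; last by rewrite mule_ge0// lee_fin expdens_ge0.
have s0 : (0 < s)%R by lra.
rewrite EFinM; apply: lee_pmul.
- by rewrite lee_fin expR_ge0.
- by rewrite lee_fin mulr_ge0// ltW.
- by rewrite lee_fin expdensE s0 ler_expR; lra.
apply: (@le_trans _ _ (\int[leb]_(z in `[2^-1%R, 1%R]) b%:E)).
  rewrite integral_cst//= lebesgue_measure_itv/= lte_fin invf_lt1// ltr1n -EFinB -EFinM lee_fin.
  by rewrite (_ : 1 - 2^-1 = 2^-1)%R//; lra.
rewrite integral_mkcond; apply: le_integral_pointwise => z _; rewrite patchE indicE.
case: ifPn => [|_]; last by rewrite mulr0.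
rewrite mem_setE in_itv/= => /andP[z1 z2]; rewrite lee_fin mulr1 /b /heat1.
apply: ler_pM; rewrite ?powR_ge0 ?expR_ge0//.
  rewrite !powRN lef_pV2 ?posrE ?powR_gt0 ?mulr_gt0 ?pi_gt0//.
  have pi0 := @pi_gt0 R.
  have hle : (4 * pi * s <= 8 * pi)%R by nra.
  have hge : (0 <= 4 * pi * s)%R by nra.
  apply: ge0_ler_powR; rewrite ?nnegrE//.
  exact: le_trans hle.
rewrite ler_expR mulNr lerN2 ler_pdivrMr; last by lra.
have : (z ^+ 2 <= 1)%R by rewrite expr2; nra.
nra.
Qed.

Lemma measurable_cos : measurable_fun setT (@cos R : MR -> MR).
Proof. by apply: continuous_measurable_fun; exact: continuous_cos. Qed.

(** This is [1 - lam], in closed form [k^2 / (1 + k^2)]; the integrand [1 - cos] is nonnegative, so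
    monotonicity yields its bounds. *)
Definition cosgap (k : R) : R := fine (bessel1 (fun z => 1 - cos (k * z))%R).

Lemma measurable_cosk (k : R) : measurable_fun setT ((fun z => cos (k * z)) : MR -> MR).
Proof. by apply: (measurableT_comp measurable_cos); exact: measurable_funM. Qed.

Lemma bessel1_cosgap k : bessel1 (fun z => 1 - cos (k * z))%R = (cosgap k)%:E.
Proof.
rewrite /cosgap fineK// ge0_fin_numE.
  apply: (@le_lt_trans _ _ (bessel1 (fun=> 2%R))); last by rewrite bessel1_cst// ltry.
  by apply: le_bessel1 => z; have := cos_geN1 (k * z)%R; lra.
by apply: bessel1_ge0 => z; rewrite subr_ge0 cos_le1.
Qed.

Lemma cosgap_ge0 k : (0 <= cosgap k)%R.
Proof. by rewrite -lee_fin -bessel1_cosgap; apply: bessel1_ge0 => z; rewrite subr_ge0 cos_le1. Qed.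

Lemma cosgap_le2 k : (cosgap k <= 2)%R.
Proof.
rewrite -lee_fin -bessel1_cosgap; apply: (@le_trans _ _ (bessel1 (fun=> 2%R))); last by rewrite bessel1_cst.
by apply: le_bessel1 => z; have := cos_geN1 (k * z)%R; lra.
Qed.

Lemma cosgap_ge : exists2 c : R, (0 < c)%R & forall k, (0 < k <= 1)%R -> (c * k ^+ 2 <= cosgap k)%R.
Proof.
have [c c0 Hc] := bessel1_box_gt0.
have c1 := @cos1_gt0 R.
(* On the box [z >= 1/2], whence the factor [1/4] relative to [one_sub_cos_ge]. *)
pose e : R := (cos 1 ^+ 2 / 8)%R.
have e0 : (0 < e)%R by rewrite divr_gt0// exprn_gt0.
exists (e * c)%R; first by rewrite mulr_gt0.
move=> k /andP[k0 k1]; rewrite -lee_fin -bessel1_cosgap.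
have ek : (0 <= e * k ^+ 2)%R by rewrite mulr_ge0 ?sqr_ge0// ltW.
apply: (@le_trans _ _ (bessel1 (fun z => e * k ^+ 2 * \1_(`[2^-1%R, 1%R]%classic) z)%R)).
  rewrite bessel1Zl//.
  by rewrite mulrAC EFinM; apply: lee_wpmul2l; rewrite ?lee_fin.
apply: le_bessel1 => z; rewrite indicE; case: (boolP (_ \in _)) => [|_]; last by rewrite mulr0 subr_ge0 cos_le1.
rewrite mem_setE in_itv/= => /andP[z1 z2]; rewrite mulr1.
have kz : (0 <= k * z <= 1)%R by apply/andP; split; nra.
apply: le_trans (one_sub_cos_ge kz).
rewrite exprMn /e; have : (4^-1 <= z ^+ 2)%R by nra.
have : (0 <= cos 1 ^+ 2 * k ^+ 2 :> R)%R by rewrite mulr_ge0 ?sqr_ge0.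
nra.
Qed.

(** The constant 1 keeps the integrand nonnegative. For [C >= 0], adding [C (1 - cos)] gives a
    constant, and the finite integral of the added term is subtracted. *)
Lemma bessel1_1Dcos (k C : R) : (-1 <= C <= 1)%R ->
  bessel1 (fun z => 1 + C * cos (k * z))%R = (1 + C * (1 - cosgap k))%:E.
Proof.
move=> /andP[C1 C2].
have m1 : measurable_fun setT ((fun z => 1 - cos (k * z))%R : MR -> MR).
  by apply: measurable_funB => //; exact: measurable_cosk.
have p1 z : (0 <= 1 - cos (k * z))%R by rewrite subr_ge0 cos_le1.
have [C0|/ltW C0] := leP 0%R C.
  have : bessel1 (fun z => (1 + C * cos (k * z)) + C * (1 - cos (k * z)))%R = (1 + C)%:E.
    rewrite -[RHS]bessel1_cst; last by lra.
    by congr bessel1; apply: funext => z; ring.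
  rewrite (@bessel1D _ (fun z => 1 + C * cos (k * z))%R (fun z => C * (1 - cos (k * z)))%R).
  - rewrite bessel1Zl// bessel1_cosgap -EFinM => H.
    have {H} := congr1 (fun x => x - (C * cosgap k)%:E) H.
    by rewrite addeK// => ->; rewrite -EFinB; congr EFin; ring.
  - by apply: measurable_funD => //; apply: measurable_funM => //; exact: measurable_cosk.
  - exact: measurable_funM.
  - by move=> z; have := cos_geN1 (k * z)%R; have := cos_le1 (k * z)%R; nra.
  - by move=> z; rewrite mulr_ge0.
have -> : (fun z => 1 + C * cos (k * z))%R = (fun z => (1 + C) + (- C) * (1 - cos (k * z)))%R.
  by apply: funext => z; ring.
rewrite (@bessel1D _ (fun=> 1 + C)%R (fun z => - C * (1 - cos (k * z)))%R)//.
- rewrite bessel1_cst; last by lra.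
  rewrite bessel1Zl//; last by lra.
  by rewrite bessel1_cosgap -EFinM -EFinD; congr EFin; ring.
- exact: measurable_funM.
- by move=> z; lra.
- by move=> z; rewrite mulr_ge0//; lra.
Qed.

(** The sine terms cancel on symmetrization: [cos (k(x+z)) + cos (k(x-z)) = 2 cos (k x) cos (k
    z)]. *)
Lemma bessel1_cos_shift (k x : R) :
  bessel1 (fun z => 1 + cos (k * (x + z)))%R <= (1 + cos (k * x) * (1 - cosgap k))%:E.
Proof.
have cD : (-1 <= cos (k * x) <= 1)%R by rewrite cos_geN1 cos_le1.
apply: (@bessel1_sym_le _ _ (fun z => 1 + cos (k * x) * cos (k * z))%R).
- apply: measurable_funD => //; apply: (measurableT_comp measurable_cos).
  by apply: measurable_funM => //; exact: measurable_funD.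
- by move=> z; have := cos_geN1 (k * (x + z))%R; lra.
- by move=> z; rewrite mulrDr mulrBr cosD cosB; lra.
- by rewrite bessel1_1Dcos.
Qed.

(* The left-hand side is the image of [A - D cos(k x)], [cos(k x)] being an eigenfunction. *)
Lemma bessel1_cos_lower (k x A D : R) : (0 <= D)%R ->
  (A - D * (1 - cosgap k) * cos (k * x))%:E <=
  bessel1 (fun z => Num.max 0 (A - D * cos (k * (x + z))))%R.
Proof.
move=> D0; set h := (fun z => _ : R).
have h0 z : (0 <= h z)%R by rewrite le_max lexx.
have cx : (-1 <= cos (k * x) <= 1)%R by rewrite cos_geN1 cos_le1.
have g0 := cosgap_ge0 k; have g2 := cosgap_le2 k.
(* If [A + D < 0], the left-hand side is at most [- D (1 + lam cos (k x)) <= 0], since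
   [|lam| <= 1]. *)
have [AD|AD] := ltP (A + D)%R 0%R.
  apply: (@le_trans _ _ 0); last exact: bessel1_ge0.
  rewrite lee_fin; move: cx => /andP[x1 x2].
  have H : (0 <= 1 + (1 - cosgap k) * cos (k * x))%R by nra.
  have := mulr_ge0 D0 H; nra.
have mc : measurable_fun setT ((fun z => cos (k * (x + z))) : MR -> MR).
  apply: (measurableT_comp measurable_cos).
  by apply: measurable_funM => //; exact: measurable_funD.
have m1 : measurable_fun setT ((fun z => 1 + cos (k * (x + z)))%R : MR -> MR).
  exact: measurable_funD.
have p1 z : (0 <= 1 + cos (k * (x + z)))%R by have := cos_geN1 (k * (x + z))%R; lra.
(* The constant [A + D] lies below [h] plus the nonnegative [D (1 + cos)], whose integral is bounded
   above and then subtracted. *)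
have : (A + D)%:E <= bessel1 (fun z => h z + D * (1 + cos (k * (x + z))))%R.
  apply: (@le_trans _ _ (bessel1 (fun=> A + D)%R)); first by rewrite bessel1_cst.
  apply: le_bessel1 => z.
  have : (A - D * cos (k * (x + z)) <= h z)%R by rewrite le_max lexx orbT.
  lra.
rewrite (@bessel1D _ h (fun z => D * (1 + cos (k * (x + z))))%R)//; last 3 first.
- apply: measurable_maxr => //; apply: measurable_funB => //; exact: measurable_funM.
- exact: measurable_funM.
- by move=> z; rewrite mulr_ge0.
rewrite bessel1Zl// => H.
have {}H : (A + D)%:E <= bessel1 h + (D * (1 + cos (k * x) * (1 - cosgap k)))%:E.
  apply: (le_trans H); rewrite leeD2l// EFinM lee_wpmul2l ?lee_fin//.
  exact: bessel1_cos_shift.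
rewrite -leeBlDr// in H; apply: le_trans H.
by rewrite -EFinB lee_fin; rewrite le_eqVlt; apply/orP; left; apply/eqP; ring.
Qed.

End cosine.

(** * The convolution operator in [n] variables *)

Section Bop_bounds.
Variable R : realType.
Local Open Scope ereal_scope.
Notation leb := (@lebesgue_measure R).
Notation MR := (measurableTypeR R).

Lemma expr2n_ge0 (x : R) N : (0 <= x ^+ (2 * N))%R.
Proof. by rewrite exprM exprn_ge0// sqr_ge0. Qed.

Lemma rV_measurable_bessel_coord n (x : 'rV[R]_n) i (f : MR -> MR) : measurable_fun setT f ->
  rV_measurable (fun y => bessel (x - y) * (f (y ord0 i))%:E).
Proof.
move=> mf d' T' h c mh mc; apply: emeasurable_funM.
  apply: measurable_bessel => j.
  have -> : (fun t : T' => (x - c t)%R ord0 j) = (fun t => x ord0 j - c t ord0 j)%R.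
    by apply: funext => t; rewrite !mxE.
  by apply: measurable_funB; [exact: measurable_cst|exact: mc].
by apply/measurable_EFinP; exact: (measurableT_comp mf (mc i)).
Qed.

Lemma intRn_bessel_sum n (x : 'rV[R]_n) (F : 'I_n -> MR -> MR) :
  (forall i, measurable_fun setT (F i)) -> (forall i z, 0 <= F i z)%R ->
  intRn (fun y => bessel (x - y) * (\sum_(i < n) F i (y ord0 i))%:E) =
  \sum_(i < n) bessel1 (fun z => F i (x ord0 i + z)%R).
Proof.
move=> mF F0.
have P0 i (y : 'rV[R]_n) : 0 <= bessel (x - y) * (F i (y ord0 i))%:E.
  by rewrite mule_ge0 ?bessel_ge0// lee_fin.
(* Induction over the list of indices, carrying along the measurability that [intRnD] needs. *)
suff H (r : seq 'I_n) :
    intRn (fun y => bessel (x - y) * (\sum_(i <- r) F i (y ord0 i))%:E) =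
      \sum_(i <- r) bessel1 (fun z => F i (x ord0 i + z)%R) /\
    rV_measurable (fun y => bessel (x - y) * (\sum_(i <- r) F i (y ord0 i))%:E).
  by have [] := H (index_enum 'I_n).
elim: r => [|i r [IH1 IH2]].
  have -> : (fun y => bessel (x - y) * (\sum_(i <- [::]) F i (y ord0 i))%:E) =
      (fun y => 0 * (cst 0 y : \bar R)).
    by apply/funext => y; rewrite big_nil mule0 mul0e.
  split; first by rewrite big_nil intRnZl ?mul0e// => d' T' h c _ _; exact: measurable_cst.
  move=> d' T' h c _ _; apply: (eq_measurable_fun (cst 0)) => [t _|]; last exact: measurable_cst.
  by rewrite mul0e.
have E : (fun y => bessel (x - y) * (\sum_(j <- i :: r) F j (y ord0 j))%:E) =
   (fun y => bessel (x - y) * (F i (y ord0 i))%:E +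
             bessel (x - y) * (\sum_(j <- r) F j (y ord0 j))%:E).
  apply/funext => y; rewrite big_cons EFinD ge0_muleDr// lee_fin//.
  by apply: sumr_ge0.
have S0 (y : 'rV[R]_n) : 0 <= bessel (x - y) * (\sum_(j <- r) F j (y ord0 j))%:E.
  by rewrite mule_ge0 ?bessel_ge0// lee_fin sumr_ge0.
rewrite E; split.
  rewrite big_cons intRnD//; last exact: rV_measurable_bessel_coord.
  by rewrite IH1 intRn_bessel_coord.
move=> d' T' h c mh mc; apply: emeasurable_funD; last exact: (IH2 _ _ _ _ mh mc).
exact: (@rV_measurable_bessel_coord _ x i _ (mF i) _ _ h c mh mc).
Qed.

Lemma intRn_Bker_le n (phi : 'rV[R]_n -> R) (psi : 'rV[R]_n -> R) x :
  (forall y, 0 <= phi y <= psi y)%R ->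
  intRn (fun y => (Bker (x - y) * phi y)%:E) <= intRn (fun y => bessel (x - y) * (psi y)%:E).
Proof.
move=> phipsi; apply: le_intRn => y; have /andP[h0 h1] := phipsi y.
rewrite EFinM; apply: lee_pmul; rewrite ?lee_fin ?Bker_ge0//.
exact: Bker_le_bessel.
Qed.

Lemma Bop_le n (phi psi : 'rV[R]_n -> R) x (c : R) :
  (forall y, 0 <= phi y <= psi y)%R ->
  intRn (fun y => bessel (x - y) * (psi y)%:E) <= c%:E -> (Bop phi x <= c)%R.
Proof.
move=> phipsi H; have {}H := le_trans (intRn_Bker_le x phipsi) H.
rewrite /Bop; set I := intRn _ in H *.
have I0 : 0 <= I.
  apply: intRn_ge0 => y; rewrite lee_fin mulr_ge0 ?Bker_ge0//.
  by have /andP[] := phipsi y.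
by move: I I0 H => [r| |]//=.
Qed.

Lemma Bop_ge0 n (phi : 'rV[R]_n -> R) x : (forall y, 0 <= phi y)%R -> (0 <= Bop phi x)%R.
Proof.
by move=> h; apply: fine_ge0; apply: intRn_ge0 => y; rewrite lee_fin mulr_ge0 ?Bker_ge0.
Qed.

(** Young's inequality [r^b <= b r + 1 - b] with [r = Y / X]: a concave power lies below its
    tangent. *)
Lemma tangent_powR (b X Y : R) : (0 < b <= 1)%R -> (0 < X)%R -> (0 < Y)%R ->
  (Y `^ b <= (1 - b) * X `^ (b - 1) * X + b * X `^ (b - 1) * Y)%R.
Proof.
move=> /andP[b0 b1] X0 Y0.
have XE : (X `^ (b - 1) * X = X `^ b)%R by rewrite mulrC mulr_powRB1// ltW.
have [->|bn1] := eqVneq b 1%R.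
  by rewrite subrr mul0r mul0r add0r powRr0 !mul1r powRr1// ltW.
have {b1 bn1} b1 : (b < 1)%R by rewrite lt_neqAle bn1.
pose r := (Y / X)%R.
have r0 : (0 < r)%R by rewrite divr_gt0.
have := @conjugate_powR R (r `^ b)%R 1%R b^-1%R (1 - b)^-1%R.
rewrite powR_ge0 ler01 !invr_gt0 b0 subr_gt0 b1 !invrK addrC subrK => /(_ isT isT isT isT erefl).
rewrite -powRrM divff ?gt_eqF// (powRr1 (ltW r0)) powR1 mulr1 mul1r => H.
have -> : Y = (r * X)%R by rewrite /r divfK// gt_eqF.
rewrite (powRM _ (ltW r0) (ltW X0)) -XE.
have : (0 < X `^ (b - 1) * X)%R by rewrite mulr_gt0// powR_gt0.
move: H; set P := (X `^ _)%R; set Q := (r `^ _)%R => H PX.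
rewrite [leRHS](_ : _ = (r * b + (1 - b)) * (P * X))%R; last by ring.
by rewrite ler_wpM2r// ltW.
Qed.

(** A substitute for [(T + |x|^2)^N] that is a sum of functions of one coordinate. *)
Definition evenpoly N (T : R) n (x : 'rV[R]_n) : R :=
  (\sum_(i < n) (T ^+ N + x ord0 i ^+ (2 * N)))%R.

Lemma evenpoly_gt0 N T n (x : 'rV[R]_n) : (0 < n)%N -> (1 <= T)%R -> (0 < evenpoly N T x)%R.
Proof.
case: n x => // n x _ T1; rewrite /evenpoly big_ord_recl ltr_pwDl//.
  by rewrite ltr_pwDl ?expr2n_ge0// exprn_gt0//; lra.
by apply: sumr_ge0 => i _; rewrite addr_ge0 ?expr2n_ge0// exprn_ge0//; lra.
Qed.

(** The tangent at the value [X] at the point [x] replaces the concave power by an affine function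
    of [evenpoly], to which the one-coordinate formula applies. *)
Lemma bessel_evenpoly_powR N n : (0 < N)%N -> (0 < n)%N ->
  exists2 C : R, (0 < C)%R & forall (b T : R) (x : 'rV[R]_n), (0 < b <= 1)%R -> (1 <= T)%R ->
  intRn (fun y => bessel (x - y) * (evenpoly N T y `^ b)%:E) <=
    ((1 + C / T) * evenpoly N T x `^ b)%:E.
Proof.
move=> N0 n0; have [C C0 HC] := @bessel1_evenpoly R N N0; exists C => // b T x b01 T1.
have /andP[b0 b1] := b01.
set X := evenpoly N T x.
have X0 : (0 < X)%R by exact: evenpoly_gt0.
pose q (z : R) : R := (T ^+ N + z ^+ (2 * N))%R.
have q0 z : (0 <= q z)%R.
  by rewrite addr_ge0 ?expr2n_ge0// exprn_ge0//; lra.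
pose k := (X `^ (b - 1))%R.
have k0 : (0 <= k)%R by exact: powR_ge0.
pose F (i : 'I_n) (z : R) : R := ((1 - b) * k * q (x ord0 i) + b * k * q z)%R.
have bk0 : (0 <= b * k)%R by rewrite mulr_ge0// ltW.
have bk1 : (0 <= (1 - b) * k)%R by rewrite mulr_ge0//; lra.
have mq : measurable_fun setT (q : MR -> MR).
  by apply: measurable_funD => //; exact: measurable_funX.
apply: (@le_trans _ _ (intRn (fun y => bessel (x - y) * (\sum_(i < n) F i (y ord0 i))%:E))).
  apply: le_intRn => y; apply: lee_wpmul2l; first exact: bessel_ge0.
  have -> : (\sum_(i < n) F i (y ord0 i) = (1 - b) * k * X + b * k * evenpoly N T y)%R.
    by rewrite /F big_split /= -2!mulr_sumr.
  by rewrite lee_fin; exact: (tangent_powR b01 X0 (evenpoly_gt0 N y n0 T1)).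
rewrite intRn_bessel_sum; last 2 first.
- by move=> i; apply: measurable_funD => //; exact: measurable_funM.
- by move=> i z; rewrite addr_ge0// mulr_ge0.
apply: (@le_trans _ _ (\sum_(i < n) (k * ((1 + C / T) * q (x ord0 i)))%:E)); last first.
  rewrite sumEFin lee_fin -!mulr_sumr -/X mulrCA -/(evenpoly N T x) -/X /k.
  by rewrite [(_ * X)%R]mulrC mulr_powRB1// ltW.
apply: lee_sum => i _; rewrite /F.
have mq' : measurable_fun setT ((fun z => q (x ord0 i + z))%R : MR -> MR).
  by apply: (measurableT_comp mq); exact: measurable_funD.
rewrite (@bessel1D _ (fun=> (1 - b) * k * q (x ord0 i))%R (fun z => b * k * q (x ord0 i + z))%R)//; last 3 first.
- exact: measurable_funM.
- by move=> z; rewrite mulr_ge0.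
- by move=> z; rewrite mulr_ge0.
rewrite (bessel1_cst (mulr_ge0 bk1 (q0 (x ord0 i)))) bessel1Zl//.
apply: (@le_trans _ _ (((1 - b) * k * q (x ord0 i))%:E +
   (b * k)%:E * ((1 + C / T) * q (x ord0 i))%:E)).
  by rewrite leeD2l// lee_wpmul2l ?lee_fin//; exact: HC.
rewrite -EFinM -EFinD lee_fin.
have CT : (0 <= C / T)%R by rewrite divr_ge0//; lra.
have kq : (0 <= k * q (x ord0 i))%R by rewrite mulr_ge0.
(* The error carries a factor [b <= 1], which is discarded; so [C] does not depend on [b]. *)
rewrite -subr_ge0 [leRHS](_ : _ = (1 - b) * (C / T) * (k * q (x ord0 i)))%R; last by ring.
by apply: mulr_ge0 => //; apply: mulr_ge0 => //; lra.
Qed.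

(** One nonzero coordinate suffices: [e^(-z_i^2 / (4s))] outweighs the singular factor
    [s^(-n/2)]. *)
Lemma bessel_fin n (z : 'rV[R]_n) i : z ord0 i != 0%R -> bessel z < +oo.
Proof.
move=> zi; pose z2 := (z ord0 i ^+ 2)%R.
have z20 : (0 < z2)%R by rewrite exprn_even_gt0.
have pi0 := @pi_gt0 R.
pose kap : R := (1 + (pi * z2)^-1)%R.
have kap1 : (1 <= kap)%R by rewrite lerDl invr_ge0 mulr_ge0 ?ltW.
pose C : R := (kap ^+ n * (n`!%:R * expR 1))%R.
have C0 : (0 <= C)%R by rewrite !mulr_ge0 ?exprn_ge0 ?expR_ge0//; lra.
apply: (@le_lt_trans _ _ (\int[leb]_s (C%:E * (expdens s)%:E))); last first.
  rewrite ge0_integralZl ?lee_fin//.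
  - by rewrite integral_expdens mule1 ltry.
  - by apply/measurable_EFinP; exact: measurable_expdens.
  - by move=> s _; rewrite lee_fin expdens_ge0.
apply: le_integral_pointwise => s _; rewrite -EFinM lee_fin expdensE.
case: ifPn => s0; last by rewrite mul0r mulr0.
rewrite mulrC ler_wpM2r ?expR_ge0//.
pose w := (z2 / (4 * s))%R.
have sn0 : s != 0%R by rewrite gt_eqF.
have w0 : (0 <= w)%R by rewrite divr_ge0 ?ltW// mulr_gt0.
pose g : R := ((4 * pi * s) `^ (- 2^-1))%R.
have ps0 : (0 < 4 * pi * s)%R by rewrite !mulr_gt0.
have g0 : (0 <= g)%R by exact: powR_ge0.
(* [g^2 = 1 / (4 pi s)] is a multiple of [w], so powers of [g] turn into powers of [1 + w]. *)
have g2 : (g ^+ 2 = w / (pi * z2))%R.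
  have z2n : z2 != 0%R by rewrite gt_eqF.
  have pin : (pi : R) != 0%R by rewrite gt_eqF.
  rewrite -powR_mulrn// -powRrM mulNr mulVf// (powR_inv1 (ltW ps0)).
  by rewrite /w; move: (pi : R) pin => P pin; field; rewrite z2n pin sn0.
have gk : (g <= kap * (1 + w))%R.
  have : (g <= 1 + g ^+ 2)%R by have := sqr_ge0 (g - 1)%R; nra.
  move=> /le_trans; apply; rewrite g2 /kap.
  have : (0 <= (pi * z2)^-1)%R by rewrite invr_ge0 mulr_ge0 ?ltW.
  nra.
have h1 : (\prod_(j < n) heat1 s (z ord0 j) <= g ^+ n * expR (- w))%R.
  rewrite big_split/= prodr_const card_ord -/g ler_wpM2l ?exprn_ge0//.
  rewrite (bigD1 i)//= -[leRHS]mulr1.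
  have -> : (- z ord0 i ^+ 2 / (4 * s) = - w)%R by rewrite /w mulNr.
  rewrite ler_wpM2l ?expR_ge0//.
  apply: prodr_ile1 => j _; rewrite expR_ge0/= -expR0 ler_expR mulNr oppr_le0.
  by rewrite divr_ge0 ?sqr_ge0// mulr_ge0// ltW.
apply: (le_trans h1).
apply: (@le_trans _ _ ((kap * (1 + w)) ^+ n * expR (- w))%R).
  rewrite ler_wpM2r ?expR_ge0// lerXn2r// nnegrE.
  by rewrite mulr_ge0//; lra.
rewrite exprMn /C -!mulrA ler_wpM2l ?exprn_ge0//; first by lra.
have w1 : (0 <= 1 + w)%R by lra.
apply: (@le_trans _ _ (n`!%:R * expR (1 + w) * expR (- w))%R).
  by rewrite ler_wpM2r ?expR_ge0//; exact: exprn_le_fact_expR.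
by rewrite -mulrA -expRD -addrA subrr addr0.
Qed.

(** The two kernels can differ only where [bessel] is infinite, hence only on the null hyperplane on
    which the first coordinates of [x] and [y] agree. *)
Lemma intRn_Bker_ge n (x : 'rV[R]_n) (i : 'I_n) (f : MR -> MR) :
  measurable_fun setT f -> (forall z, 0 <= f z)%R ->
  intRn (fun y => bessel (x - y) * (f (y ord0 i))%:E) <=
  intRn (fun y => (Bker (x - y) * f (y ord0 i))%:E).
Proof.
case: n x i => [|n] x i mf f0; first by case: i.
rewrite /=.
have mF := @rV_measurable_bessel_coord _ x i f mf.
have F0 (y : 'rV[R]_n.+1) : 0 <= bessel (x - y) * (f (y ord0 i))%:E.
  by rewrite mule_ge0 ?bessel_ge0// lee_fin.
rewrite (@ge0_negligible_integral _ _ _ leb setT [set x ord0 ord0])//.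
- rewrite integral_mkcond; apply: le_integral_pointwise => s _; rewrite patchE.
  case: ifPn => [|_]; last first.
    by apply: intRn_ge0 => y; rewrite lee_fin mulr_ge0 ?Bker_ge0.
  rewrite inE /= => -[_ /eqP sx].
  apply: le_intRn => y; rewrite EFinM; apply: lee_wpmul2r; first by rewrite lee_fin.
  rewrite BkerE fineK// ge0_fin_numE ?bessel_ge0//; apply: (@bessel_fin _ _ ord0).
  by rewrite !mxE; have := row_mx1_ord0 s y; rewrite mxE => ->; rewrite subr_eq0 eq_sym.
- by apply: (measurable_intRn (rV_measurable_row mF)).
- by move=> s _; exact: intRn_ge0.
- by have := lebesgue_measure_set1 (x ord0 ord0).
Qed.

(** The majorant [psi] makes the integral finite; at infinity [fine] would return 0. *)
Lemma Bop_ge n (phi psi : 'rV[R]_n -> R) (x : 'rV[R]_n) (i : 'I_n) (f : MR -> MR) (v : R) :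
  measurable_fun setT f -> (forall z, 0 <= f z)%R ->
  (forall y : 'rV[R]_n, f (y ord0 i) <= phi y <= psi y)%R ->
  intRn (fun y => bessel (x - y) * (psi y)%:E) < +oo ->
  v%:E <= bessel1 (fun z => f (x ord0 i + z)%R) -> (v <= Bop phi x)%R.
Proof.
move=> mf f0 H psioo vK.
have phi0 y : (0 <= phi y <= psi y)%R.
  by have /andP[h1 ->] := H y; rewrite (le_trans (f0 _) h1).
rewrite -lee_fin /Bop fineK.
  apply: (le_trans vK); rewrite -intRn_bessel_coord//.
  apply: (le_trans (intRn_Bker_ge _ _ mf f0)); apply: le_intRn => y.
  by rewrite lee_fin ler_wpM2l ?Bker_ge0//; have /andP[] := H y.
rewrite ge0_fin_numE; first exact: (le_lt_trans (intRn_Bker_le x phi0)).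
apply: intRn_ge0 => y; rewrite lee_fin mulr_ge0 ?Bker_ge0//.
by have /andP[] := phi0 y.
Qed.

End Bop_bounds.

(** * Comparison with sub- and supersolutions *)

Section time.
Variable R : realType.
Notation leb := (@lebesgue_measure R).
Notation MR := (measurableTypeR R).

Lemma FTC_int (F f : R -> R) (t : R) : 0 <= t ->
  (forall s, 0 <= s <= t -> is_derive s 1 F (f s)) ->
  (forall s, 0 <= s <= t -> derivable f s 1) ->
  (\int[leb]_(s in `[0%R, t]) (f s)%:E = (F t - F 0)%:E)%E.
Proof.
move=> t0 dF df; have [->|tn0] := eqVneq t 0.
  by rewrite set_itv1 integral_set1 subrr.
have {tn0}tp : 0 < t by rewrite lt_neqAle eq_sym tn0.
have cF s : 0 <= s <= t -> {for s, continuous F}.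
  move=> /dF Hs; apply: differentiable_continuous; apply/derivable1_diffP.
  exact: ex_derive.
rewrite (@continuous_FTC2 _ f F 0 t tp)//.
- apply: continuous_in_subspaceT => s; rewrite inE /= in_itv/= => /df Hs.
  by apply: differentiable_continuous; apply/derivable1_diffP.
- split.
  + by move=> s; rewrite in_itv/= => /andP[s0 st]; have := dF s; rewrite !ltW// => /(_ isT) H; exact: ex_derive.
  + by apply: cvg_at_right_filter; apply: cF; rewrite lexx ltW.
  + by apply: cvg_at_left_filter; apply: cF; rewrite lexx ltW.
- move=> s; rewrite in_itv/= => /andP[s0 st]; have := dF s; rewrite !ltW// => /(_ isT) H.
  by rewrite derive1E; exact: derive_val.
Qed.

Lemma fineD_le (x y : \bar R) (c : R) : (0 <= x)%E -> (0 <= y)%E -> (x + y <= c%:E)%E ->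
  fine x + fine y <= c.
Proof. by case: x => [r| |]; case: y => [s| |]. Qed.

(** Additivity is applied to the measurable majorants [f1], [f2]; the integrands [g1], [g2] enter by
    monotonicity. *)
Lemma int0_add_le (F f g1 g2 f1 f2 : R -> R) (t : R) : 0 <= t ->
  (forall s, 0 <= s <= t -> is_derive s 1 F (f s)) ->
  (forall s, 0 <= s <= t -> derivable f s 1) ->
  measurable_fun setT (f1 : MR -> MR) -> measurable_fun setT (f2 : MR -> MR) ->
  (forall s, 0 <= s <= t -> 0 <= g1 s <= f1 s) ->
  (forall s, 0 <= s <= t -> 0 <= g2 s <= f2 s) ->
  (forall s, 0 <= s <= t -> f1 s + f2 s = f s) ->
  int0 t g1 + int0 t g2 <= F t - F 0.
Proof.
move=> t0 dF df m1 m2 H1 H2 H12.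
have E : (\int[leb]_(s in `[0%R, t]) (f1 s)%:E + \int[leb]_(s in `[0%R, t]) (f2 s)%:E = (F t - F 0)%:E)%E.
  rewrite -(FTC_int t0 dF df) -ge0_integralD//.
  - by apply: eq_integral => s; rewrite inE /= in_itv/= => /H12 <-.
  - by move=> s /=; rewrite in_itv/= => /H1 /andP[]; rewrite lee_fin; exact: le_trans.
  - by apply: measurable_funTS; apply/measurable_EFinP.
  - by move=> s /=; rewrite in_itv/= => /H2 /andP[]; rewrite lee_fin; exact: le_trans.
  - by apply: measurable_funTS; apply/measurable_EFinP.
have J (g h : R -> R) : (forall s, 0 <= s <= t -> 0 <= g s <= h s) ->
   (0 <= \int[leb]_(s in `[0%R, t]) (g s)%:E)%E /\
   (\int[leb]_(s in `[0%R, t]) (g s)%:E <= \int[leb]_(s in `[0%R, t]) (h s)%:E)%E.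
  move=> H; split.
    by apply: integral_ge0 => s /=; rewrite in_itv/= => /H /andP[]; rewrite lee_fin.
  by apply: le_integral_pointwise => s /=; rewrite in_itv/= => /H /andP[]; rewrite lee_fin.
have [p1 q1] := J _ _ H1; have [p2 q2] := J _ _ H2.
rewrite /int0.
have : (\int[leb]_(s in `[0%R, t]) (g1 s)%:E + \int[leb]_(s in `[0%R, t]) (g2 s)%:E <= (F t - F 0)%:E)%E.
  by rewrite -E; exact: leeD.
exact: fineD_le.
Qed.

(** The bound [c] makes the integral finite, so that [fine] keeps its value. *)
Lemma int0_ge (F f g : R -> R) (t c : R) : 0 <= t ->
  (forall s, 0 <= s <= t -> is_derive s 1 F (f s)) ->
  (forall s, 0 <= s <= t -> derivable f s 1) ->
  (forall s, 0 <= s <= t -> f s <= g s) ->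
  (forall s, 0 <= s <= t -> 0 <= g s <= c) ->
  F t - F 0 <= int0 t g.
Proof.
move=> t0 dF df H1 H2; rewrite -lee_fin -(FTC_int t0 dF df) /int0 fineK.
  by apply: le_integral_pointwise => s /=; rewrite in_itv/= => /H1; rewrite lee_fin.
rewrite ge0_fin_numE; last first.
  by apply: integral_ge0 => s /=; rewrite in_itv/= => /H2 /andP[]; rewrite lee_fin.
apply: (@le_lt_trans _ _ (\int[leb]_(s in `[0%R, t]) c%:E))%E.
  by apply: le_integral_pointwise => s /=; rewrite in_itv/= => /H2 /andP[]; rewrite lee_fin.
rewrite integral_cst//= lebesgue_measure_itv/= lte_fin.
by case: ifPn => _; rewrite ?mule0 ?ltry// -EFinB -EFinM ltry.
Qed.

Lemma int0_ge0 (g : R -> R) (t : R) : (forall s, 0 <= s <= t -> 0 <= g s) -> 0 <= int0 t g.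
Proof.
move=> H; apply: fine_ge0; apply: integral_ge0 => s /=.
by rewrite in_itv/= => /H; rewrite lee_fin.
Qed.

(** The exponent [E], with [al = 1 + C/T] and [ka = K T^(-m)]; the first summand accounts for the
    linear term, the second for the source. *)
Definition rate (al ka m t : R) : R := al * t + ka * ((1 + t) `^ m - 1).

Lemma is_derive_powR1D (m s : R) : 0 <= s ->
  is_derive s 1 (fun t => (1 + t) `^ m) (m * (1 + s) `^ (m - 1)).
Proof.
move=> s0; have p : 0 < 1 + s by lra.
have := @is_derive1_comp R (fun x => x `^ m) (fun t => 1 + t) s (m * (1 + s) `^ (m - 1)) 1.
rewrite mulr1; apply.
  exact: is_derive1_powR.
by apply: is_derive_eq; rewrite add0r mulr1.
Qed.

Lemma is_derive_rate (al ka m s : R) : 0 <= s ->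
  is_derive s 1 (rate al ka m) (al + ka * (m * (1 + s) `^ (m - 1))).
Proof.
move=> s0; have H := is_derive_powR1D m s0; rewrite /rate.
by apply: is_derive_eq; rewrite /cst /GRing.scale/=; ring.
Qed.

Lemma is_derive_exp_rate (c al ka m s : R) : 0 <= s ->
  is_derive s 1 (fun t => c * expR (rate al ka m t))
    ((al + ka * (m * (1 + s) `^ (m - 1))) * (c * expR (rate al ka m s))).
Proof.
move=> s0.
have H := is_derive_rate al ka m s0.
have H2 : is_derive s 1 (fun t => expR (rate al ka m t))
    (expR (rate al ka m s) * (al + ka * (m * (1 + s) `^ (m - 1)))).
  exact: is_derive1_comp.
apply: is_derive_eq; rewrite /GRing.scale/=; ring.
Qed.

Lemma derivable_exp_rate (c al ka m s : R) : 0 <= s ->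
  derivable (fun t : R => (al + ka * (m * (1 + t) `^ (m - 1))) * (c * expR (rate al ka m t))) s 1.
Proof.
move=> s0; have H1 := is_derive_exp_rate c al ka m s0.
have H2 := is_derive_powR1D (m - 1) s0.
apply: derivableM; last exact: ex_derive.
apply: derivableD; first exact: ex_derive.
apply: derivableM; first exact: ex_derive.
by apply: derivableM; exact: ex_derive.
Qed.

Lemma is_derive_expRM (l s : R) : is_derive s 1 (fun s => expR (l * s)) (l * expR (l * s)).
Proof.
have := @is_derive1_comp R expR (fun t => l * t) s (expR (l * s)) l.
rewrite (mulrC l (expR _)); apply.
by apply: is_derive_eq; rewrite /cst /GRing.scale/=; ring.
Qed.

Lemma is_derive_exp3 (c be l C M s : R) :
  is_derive s 1 (fun s => c * (be * expR s - expR (l * s) * C - M * expR (2 * s)))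
    (c * (be * expR s - (l * expR (l * s)) * C - (2 * M) * expR (2 * s))).
Proof.
have d1 := is_derive_expRM l s; have d2 := is_derive_expRM 2 s.
by apply: is_derive_eq; rewrite /cst /GRing.scale/=; ring.
Qed.

End time.

Section comparison.
Variable R : realType.
Notation leb := (@lebesgue_measure R).
Notation MR := (measurableTypeR R).

Lemma expRM_powR (x l : R) : expR (l * x) = expR x `^ l.
Proof. by rewrite /powR gt_eqF ?expR_gt0// expRK. Qed.

Lemma le_geometric_limit (x y M q : R) : 0 <= q < 1 ->
  (forall j, x <= y + M * q ^+ j) -> x <= y.
Proof.
move=> /andP[q0 q1] H.
have h : (fun j => y + M * q ^+ j) @ \oo --> y + M * 0.
  apply: cvgD; first exact: cvg_cst.
  apply: cvgM; first exact: cvg_cst.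
  by apply: cvg_expr; rewrite ger0_norm.
rewrite mulr0 addr0 in h.
rewrite -(cvg_lim _ h)//; apply: limr_ge; first by apply/cvg_ex; exists y.
by apply: nearW.
Qed.

(** * Comparison with a supersolution *)

Section upper.
Variables (n : nat) (p al ka m A0 T : R) (V : 'rV[R]_n -> R -> R).
Variables (u0 : 'rV[R]_n -> R) (mu : R -> 'rV[R]_n -> R) (Phi : 'rV[R]_n -> R).
Hypotheses (p01 : 0 < p < 1) (al1 : 1 <= al) (ka0 : 0 <= ka) (m0 : 0 < m)
  (T0 : 0 <= T) (A1 : 1 <= A0) (Phi0 : forall x, 0 <= Phi x).
Hypothesis HB : forall x (c : R), 0 <= c ->
  (intRn (fun y => bessel (x - y) * (c * Phi y)%:E) <= (c * (al * Phi x))%:E)%E.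
Hypothesis V0 : forall y (t : R), 0 <= t <= T -> 0 <= V y t.
Hypothesis HV : forall y (t : R), 0 <= t <= T ->
  al * (V y t * Phi y `^ p) <= ka * (m * (1 + t) `^ (m - 1)) * Phi y.
Hypothesis mu0 : forall (t : R) x, 0 <= t <= T -> 0 <= mu t x.
Hypothesis mueq : forall (t : R) x, 0 <= t <= T ->
    mu t x = u0 x + int0 t (fun tau => Bop (mu tau) x)
             + int0 t (fun tau => expR ((1 - p) * tau) *
                         Bop (fun y => V y tau * (mu tau y) `^ p) x).
Hypothesis u0le : forall x, u0 x <= A0 * Phi x.

Notation E := (rate al ka m).

Let E_ge (t : R) : 0 <= t -> t <= E t.
Proof.
move=> t0; rewrite /rate; have al1' := al1.
have : 1 <= (1 + t) `^ m.
  by rewrite -[leLHS](powRr0 (1 + t)); apply: ler_powR; [rewrite lerDl|exact: ltW].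
by move=> h; rewrite -[leLHS]addr0 lerD//; [rewrite ler_peMl|rewrite mulr_ge0// subr_ge0].
Qed.

Let E_le (s t : R) : 0 <= s -> s <= t -> E s <= E t.
Proof.
move=> s0 st; have m0' := m0; have al1' := al1; rewrite /rate lerD//; first by rewrite ler_wpM2l//; lra.
rewrite ler_wpM2l// lerB// ge0_ler_powR// ?nnegrE; lra.
Qed.

Let E0 : E 0 = 0.
Proof. by rewrite /rate mulr0 addr0 powR1 subrr mulr0 addr0. Qed.

(** A bound with constant [(1 + M) A0] reproduces itself in the integral equation, except that the
    datum contributes [A0] and not [(1 + M) A0]; the difference [M A0] is the gain. *)
Let upper_step (M t : R) x : 0 <= M -> 0 <= t <= T ->
  (forall (s : R) y, 0 <= s <= T -> mu s y <= (1 + M) * A0 * expR (E s) * Phi y) ->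
  mu t x <= ((1 + M) * A0 * expR (E t) - M * A0) * Phi x.
Proof.
move=> M0 tT H; have /andP[t0 tT'] := tT; have /andP[p0 p1] := p01.
have al1' := al1; have A1' := A1.
have c0 : 1 <= (1 + M) * A0 by nra.
set c := (1 + M) * A0 in c0 H *.
pose kf (s : R) : R := ka * (m * (1 + s) `^ (m - 1)).
have kf0 s : 0 <= kf s by rewrite !mulr_ge0 ?powR_ge0// ltW.
pose X (s : R) : R := c * expR (E s).
have X0 s : 0 < X s by rewrite mulr_gt0 ?expR_gt0//; lra.
(* This yields [e^((1-p)s) X^p <= X], which makes the source linear in [X]. *)
have XE (s : R) : 0 <= s -> expR s <= X s.
  move=> s0; apply: (@le_trans _ _ (expR (E s))); first by rewrite ler_expR E_ge.
  by rewrite ler_peMl// expR_ge0.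
have mX : measurable_fun setT (X : MR -> MR).
  apply: measurable_funM => //; apply: (measurableT_comp (@measurable_expR R)).
  apply: measurable_funD; first exact: measurable_funM.
  apply: measurable_funM => //; apply: measurable_funB => //.
  by apply: (measurableT_comp (measurable_powR m)); exact: measurable_funD.
have mk : measurable_fun setT (kf : MR -> MR).
  apply: measurable_funM => //; apply: measurable_funM => //.
  by apply: (measurableT_comp (measurable_powR (m - 1))); exact: measurable_funD.
have := @int0_add_le R (fun s => c * Phi x * expR (E s)) (fun s => (al + kf s) * (c * Phi x * expR (E s)))
  (fun tau => Bop (mu tau) x)
  (fun tau => expR ((1 - p) * tau) * Bop (fun y => V y tau * (mu tau y) `^ p) x)
  (fun s => al * (X s * Phi x)) (fun s => kf s * (X s * Phi x)) t t0.
move=> /(_ (fun s sH => @is_derive_exp_rate R _ _ _ _ _ (proj1 (andP sH)))).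
move=> /(_ (fun s sH => @derivable_exp_rate R _ _ _ _ _ (proj1 (andP sH)))).
have sT (s : R) : 0 <= s <= t -> 0 <= s <= T.
  by move=> /andP[-> h]; rewrite (le_trans h).
have mX1 : measurable_fun setT ((fun s => al * (X s * Phi x)) : MR -> MR).
  by apply: measurable_funM => //; exact: measurable_funM.
have mX2 : measurable_fun setT ((fun s => kf s * (X s * Phi x)) : MR -> MR).
  by apply: measurable_funM => //; exact: measurable_funM.
move=> /(_ mX1 mX2).
have B1 (s : R) : 0 <= s <= t -> 0 <= Bop (mu s) x <= al * (X s * Phi x).
  move=> /sT sT1; apply/andP; split; first by apply: Bop_ge0 => y; exact: mu0.
  apply: (@Bop_le _ _ _ (fun y => X s * Phi y)).
    by move=> y; rewrite mu0//=; exact: H.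
  by rewrite mulrCA; apply: HB; exact: ltW.
have B2 (s : R) : 0 <= s <= t -> 0 <= expR ((1 - p) * s) * Bop (fun y => V y s * (mu s y) `^ p) x
     <= kf s * (X s * Phi x).
  move=> st; have sT1 := sT s st; have s0 : 0 <= s by have /andP[] := st.
  have phi0 y : 0 <= V y s * mu s y `^ p by rewrite mulr_ge0 ?powR_ge0// V0.
  apply/andP; split; first by rewrite mulr_ge0 ?expR_ge0// Bop_ge0.
  have al0 : 0 < al by lra.
  have h : Bop (fun y => V y s * (mu s y) `^ p) x <= X s `^ p * kf s * Phi x.
    (* The factor [al] on the left of [HV] pays for the factor [al] lost in applying [B]. *)
    apply: (@le_trans _ _ (X s `^ p * kf s / al * (al * Phi x))); last first.
      by rewrite mulrA divfK ?gt_eqF.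
    have Xk : 0 <= X s `^ p * kf s / al by rewrite divr_ge0 ?mulr_ge0 ?powR_ge0// ltW.
    apply: (@Bop_le _ _ _ (fun y => X s `^ p * kf s / al * Phi y)); last exact: HB.
    move=> y; rewrite phi0/=.
    apply: (@le_trans _ _ (V y s * (X s `^ p * Phi y `^ p))).
      rewrite ler_wpM2l ?V0// -(powRM _ (ltW (X0 s)) (Phi0 y)); apply: ge0_ler_powR; rewrite ?nnegrE ?(ltW p0)//.
      - exact: mu0.
      - by rewrite mulr_ge0// ltW.
      - exact: H.
    rewrite [leLHS](_ : _ = X s `^ p * (V y s * Phi y `^ p)); last by ring.
    rewrite [leRHS](_ : _ = X s `^ p * (al^-1 * (kf s * Phi y))); last by ring.
    rewrite ler_wpM2l ?powR_ge0// ler_pdivlMl//.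
    exact: HV.
  apply: (@le_trans _ _ (expR ((1 - p) * s) * (X s `^ p * kf s * Phi x))).
    by rewrite ler_wpM2l ?expR_ge0.
  rewrite [leLHS](_ : _ = kf s * (expR ((1 - p) * s) * X s `^ p * Phi x)); last by ring.
  rewrite ler_wpM2l// ler_wpM2r// expRM_powR.
  have {2}-> : X s = X s `^ (1 - p) * X s `^ p.
    by rewrite -powRD ?subrK ?powRr1 ?ltW//; apply/implyP => _; rewrite gt_eqF.
  rewrite ler_wpM2r ?powR_ge0//; apply: ge0_ler_powR; rewrite ?nnegrE ?expR_ge0 ?(ltW (X0 s))//.
    by lra.
  exact: XE.
move=> /(_ B1 B2).
have E12 (s : R) : 0 <= s <= t -> al * (X s * Phi x) + kf s * (X s * Phi x) =
    (al + kf s) * (c * Phi x * expR (E s)) by move=> _; rewrite /X; ring.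
move=> /(_ E12); rewrite E0 expR0 mulr1 => Hint.
rewrite mueq//; have := u0le x.
have -> : c * expR (E t) - M * A0 = (c * expR (E t) - c) + A0 by rewrite /c; ring.
by move: Hint; set I1 := int0 _ _; set I2 := int0 _ _; clearbody I1 I2; lra.
Qed.

Lemma upper_comparison (t : R) x : (exists M, forall (s : R) y, 0 <= s <= T -> mu s y <= M * Phi y) ->
  0 <= t <= T -> mu t x <= A0 * expR (E t) * Phi x.
Proof.
move=> [M0' HM'] tT; have A1' := A1.
have [M M0 HM] : exists2 M, 0 <= M & forall (s : R) y, 0 <= s <= T -> mu s y <= M * Phi y.
  exists (Num.max 0 M0'); first by rewrite le_max lexx.
  move=> s y sT; apply: (le_trans (HM' s y sT)).
  by rewrite ler_wpM2r// le_max lexx orbT.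
have ET0 : 0 <= E T by apply: le_trans (E_ge T0).
(* The gain [M A0] is at least the fraction [e^(-E T)] of the excess [M A0 e^(E s)], as
   [E s <= E T]. *)
pose q := 1 - expR (- E T).
have q01 : 0 <= q < 1.
  by rewrite subr_ge0 ltrBlDr ltrDl expR_gt0 andbT -expR0 ler_expR oppr_le0.
have iter j (s : R) y : 0 <= s <= T -> mu s y <= (1 + M * q ^+ j) * A0 * expR (E s) * Phi y.
  elim: j s y => [|j IH] s y sT.
    rewrite expr0 mulr1; apply: (le_trans (HM s y sT)); rewrite ler_wpM2r//.
    have Es : 1 <= expR (E s).
      by rewrite -expR0 ler_expR; have /andP[s0 _] := sT; apply: le_trans (E_ge s0).
    rewrite -[leLHS]mulr1; apply: ler_pM => //; nra.
  have Mq : 0 <= M * q ^+ j by rewrite mulr_ge0// exprn_ge0//; have /andP[] := q01.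
  apply: (le_trans (upper_step _ Mq sT IH)).
  rewrite ler_wpM2r// exprSr.
  have /andP[s0 sT'] := sT.
  have h : expR (E s) * expR (- E T) <= 1.
    by rewrite -expRD -[leRHS]expR0 ler_expR subr_le0 E_le.
  move: Mq; set N := M * q ^+ j => N0; rewrite mulrA -/N /q.
  rewrite -subr_ge0 [leRHS](_ : _ = N * A0 * (1 - expR (E s) * expR (- E T))); last by ring.
  apply: mulr_ge0; last by rewrite subr_ge0.
  by apply: mulr_ge0 => //; lra.
apply: (@le_geometric_limit _ _ (M * A0 * expR (E t) * Phi x) q) => // j.
by apply: (le_trans (iter j t x tT)); rewrite le_eqVlt; apply/orP; left; apply/eqP; ring.
Qed.

End upper.

(** * Comparison with a subsolution *)

Section lower.
Variables (n : nat) (i : 'I_n) (al be k c T Mb : R).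
Variables (u0 : 'rV[R]_n -> R) (mu : R -> 'rV[R]_n -> R) (Phi : 'rV[R]_n -> R).
Hypotheses (c0 : 0 <= c) (be1 : be <= 1) (Mb0 : 0 <= Mb).
Hypothesis HB : forall x (c : R), 0 <= c ->
  (intRn (fun y => bessel (x - y) * (c * Phi y)%:E) <= (c * (al * Phi x))%:E)%E.
Hypothesis mu0 : forall (t : R) x, 0 <= t <= T -> 0 <= mu t x <= Mb * Phi x.
Hypothesis muge : forall (t : R) x, 0 <= t <= T ->
    u0 x + int0 t (fun tau => Bop (mu tau) x) <= mu t x.
Hypothesis u0ge : forall x : 'rV[R]_n, c * (be - cos (k * x ord0 i)) <= u0 x.

Notation lam := (1 - cosgap k).

(** The error term grows like [e^(2s)], so one integration in time halves its coefficient. *)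
Let lower_step (M t : R) (x : 'rV[R]_n) : 0 <= M -> 0 <= t <= T ->
  (forall (s : R) (y : 'rV[R]_n), 0 <= s <= T ->
     c * (be * expR s - expR (lam * s) * cos (k * y ord0 i) - M * expR (2 * s)) <= mu s y) ->
  c * (be * expR t - expR (lam * t) * cos (k * x ord0 i) - M / 2 * expR (2 * t)) <= mu t x.
Proof.
move=> M0 tT H; have /andP[t0 tT'] := tT.
have sT (s : R) : 0 <= s <= t -> 0 <= s <= T.
  by move=> /andP[-> h]; rewrite (le_trans h).
set C := cos (k * x ord0 i).
pose F (s : R) : R := c * (be * expR s - expR (lam * s) * C - M / 2 * expR (2 * s)).
pose f (s : R) : R := c * (be * expR s - (lam * expR (lam * s)) * C - M * expR (2 * s)).
have dF (s : R) : 0 <= s <= t -> is_derive s 1 F (f s).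
  move=> _; have := is_derive_exp3 c be lam C (M / 2) s.
  by rewrite (_ : 2 * (M / 2) = M)// mulrC divfK.
have df (s : R) : 0 <= s <= t -> derivable f s 1.
  move=> _; rewrite /f; have H1 := is_derive_exp3 c be lam (lam * C) M s.
  have -> : (fun s : R => c * (be * expR s - lam * expR (lam * s) * C - M * expR (2 * s))) =
    (fun s : R => c * (be * expR s - expR (lam * s) * (lam * C) - M * expR (2 * s))).
    by apply/funext => z; rewrite [lam * _]mulrC mulrA.
  exact: ex_derive.
have fB (s : R) : 0 <= s <= t -> f s <= Bop (mu s) x.
  move=> /sT sT1.
  pose D := c * expR (lam * s); pose A := c * (be * expR s - M * expR (2 * s)).
  have D0 : 0 <= D by rewrite mulr_ge0 ?expR_ge0.
  (* As [mu >= 0], the lower bound may be cut off at 0, which gives the nonnegative function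
     [Bop_ge] asks for. *)
  apply: (@Bop_ge _ _ _ (fun y => Mb * Phi y) x i (fun z => Num.max 0 (A - D * cos (k * z)))).
  - apply: measurable_maxr => //; apply: measurable_funB => //; apply: measurable_funM => //.
    exact: measurable_cosk.
  - by move=> z; rewrite le_max lexx.
  - move=> y; have /andP[m1 m2] := mu0 y sT1; rewrite m2 andbT ge_max m1/=.
    by apply: le_trans (H s y sT1); rewrite le_eqVlt; apply/orP; left; apply/eqP; rewrite /A /D; ring.
  - by apply: (le_lt_trans (HB x Mb0)); rewrite ltry.
  - apply: le_trans (bessel1_cos_lower k (x ord0 i) A D0).
    by rewrite lee_fin le_eqVlt; apply/orP; left; apply/eqP; rewrite /f /A /D /C; ring.
have gB (s : R) : 0 <= s <= t -> 0 <= Bop (mu s) x <= Mb * (al * Phi x).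
  move=> /sT sT1; apply/andP; split.
    by apply: Bop_ge0 => y; have /andP[] := mu0 y sT1.
  apply: (@Bop_le _ _ _ (fun y => Mb * Phi y)); last exact: HB.
  by move=> y; exact: mu0.
have := int0_ge t0 dF df fB gB.
have := muge x tT; have := u0ge x; rewrite -/C.
have -> : F 0 = c * (be - C) - c * M / 2 by rewrite /F !mulr0 expR0; ring.
have : 0 <= c * M by rewrite mulr_ge0.
rewrite /F; set I := int0 _ _; clearbody I; lra.
Qed.

Lemma lower_comparison (t : R) (x : 'rV[R]_n) : 0 <= t <= T ->
  c * (be * expR t - expR (lam * t) * cos (k * x ord0 i)) <= mu t x.
Proof.
move=> tT; have be1' := be1.
have iter j (s : R) (y : 'rV[R]_n) : 0 <= s <= T ->
   c * (be * expR s - expR (lam * s) * cos (k * y ord0 i) - 2 * 2^-1 ^+ j * expR (2 * s)) <= mu s y.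
  elim: j s y => [|j IH] s y sT.
    (* With error coefficient 2 the left-hand side is nonpositive, so the iteration starts from
       [mu >= 0]. *)
    apply: (@le_trans _ _ 0); last by have /andP[] := mu0 y sT.
    rewrite mulr_ge0_le0// expr0 mulr1.
    have /andP[s0 _] := sT.
    have e1 : expR s <= expR (2 * s) by rewrite ler_expR; lra.
    have g0 := cosgap_ge0 k.
    have e2 : expR (lam * s) <= expR s by rewrite ler_expR; nra.
    have := cos_geN1 (k * y ord0 i); have := expR_gt0 s; have := expR_gt0 (lam * s).
    nra.
  rewrite exprSr mulrA; apply: lower_step => //.
rewrite -lerN2.
apply: (@le_geometric_limit _ _ (c * (2 * expR (2 * t))) (2^-1)) => [|j].
  by apply/andP; split; lra.
have := iter j t x tT; lra.
Qed.

End lower.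

End comparison.

(** * Weights and a priori bounds *)

Section weights.
Variable R : realType.
Notation MR := (measurableTypeR R).

Lemma enorm_ge0 n (x : 'rV[R]_n) : 0 <= enorm x.
Proof. exact: sqrtr_ge0. Qed.

Lemma sqr_enorm n (x : 'rV[R]_n) : enorm x ^+ 2 = \sum_(i < n) x ord0 i ^+ 2.
Proof. by rewrite sqr_sqrtr// sumr_ge0// => i _; exact: sqr_ge0. Qed.

Lemma sqr_coord_le n (x : 'rV[R]_n) i : x ord0 i ^+ 2 <= enorm x ^+ 2.
Proof.
rewrite sqr_enorm (bigD1 i)//= lerDl; apply: sumr_ge0 => j _; exact: sqr_ge0.
Qed.

Lemma coord_le_enorm n (x : 'rV[R]_n) i : `|x ord0 i| <= enorm x.
Proof.
rewrite -(ler_pXn2r (_ : (0 < 2)%N))// ?nnegrE ?enorm_ge0//.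
by rewrite real_normK ?num_real// sqr_coord_le.
Qed.

Lemma powR_half (x a : R) : 0 <= x -> (x ^+ 2) `^ (a / 2) = x `^ a.
Proof.
by move=> x0; rewrite -powR_mulrn// -powRrM mulrC divfK.
Qed.

Lemma powR_le (x y r : R) : 0 <= r -> 0 <= x -> x <= y -> x `^ r <= y `^ r.
Proof.
move=> r0 x0 xy; apply: ge0_ler_powR; rewrite ?nnegrE//; exact: le_trans xy.
Qed.

Lemma powR_ge1 (x r : R) : 0 <= r -> 1 <= x -> 1 <= x `^ r.
Proof. by move=> r0 x1; rewrite -[leLHS](powRr0 x); exact: ler_powR. Qed.

Lemma continuous_bounded_box n (phi : 'rV[R]_n -> R) (M : R) : continuous phi ->
  exists B, forall x : 'rV[R]_n, (forall i, `|x ord0 i| <= M) -> `|phi x| <= B.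
Proof.
move=> cphi; have [M0|M0] := ltP M 0; last first.
  pose A := [set v : 'rV[R]_n | forall i, v ord0 i \in `[- M, M]].
  have cA : compact A.
    apply: (@rV_compact _ _ (fun=> `[- M, M]%classic)) => _.
    exact: segment_compact.
  have A0 : A !=set0.
    by exists 0 => i; rewrite mxE in_itv/= M0 andbT oppr_le0.
  have cn : {within A, continuous (fun x => `|phi x|)}.
    apply: continuous_subspaceT => x.
    apply: (@continuous_comp _ _ _ phi (fun y : R => `|y|)); first exact: cphi.
    exact: norm_continuous.
  have [c cA' Hc] := EVT_max_rV A0 cA cn.
  exists (`|phi c|) => x Hx; apply: Hc; rewrite inE => i.
  by rewrite in_itv/= -ler_norml.
(* For [M < 0] the box is empty, except in dimension 0, where it is the only point. *)
case: n phi cphi => [|n] phi _.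
  by exists `|phi 0| => x _; rewrite (_ : x = 0)//; apply/matrixP => i [].
exists 0 => x /(_ ord0) h.
by move: (le_lt_trans h M0); rewrite ltNge normr_ge0.
Qed.

(** Outside a ball the growth condition applies, inside it continuity. *)
Lemma BC_bounded n (a : R) (phi : 'rV[R]_n -> R) : 0 <= a -> BC a phi ->
  exists B, forall x, `|phi x| <= B * (1 + enorm x ^+ 2) `^ (a / 2).
Proof.
move=> a0 [cphi [C [M HM]]].
have [B HB] := @continuous_bounded_box n phi M cphi.
have a2 : 0 <= a / 2 by lra.
exists (Num.max `|B| `|C|) => x.
have e0 := enorm_ge0 x; have e20 := sqr_ge0 (enorm x).
have [xM|xM] := leP M (enorm x).
  apply: (le_trans (HM x xM)); apply: (@le_trans _ _ (Num.max `|B| `|C| * enorm x `^ a)).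
    by rewrite ler_wpM2r ?powR_ge0// le_max ler_norm orbT.
  by rewrite ler_wpM2l ?le_max ?normr_ge0// -powR_half// powR_le// lerDr.
rewrite -[leLHS]mulr1; apply: ler_pM => //.
  apply: (@le_trans _ _ B); last by rewrite le_max ler_norm.
  by apply: HB => i; apply: (le_trans (coord_le_enorm x i)); exact: ltW.
by rewrite powR_ge1// lerDl.
Qed.

Section wnorm.
Variables (n : nat) (R0 a B : R) (phi : 'rV[R]_n -> R).
Hypothesis R00 : 0 < R0.
Hypothesis HB : forall x, `|phi x| <= B * (R0 ^+ 2 + enorm x ^+ 2) `^ (a / 2).

Let wgt0 (x : 'rV[R]_n) : 0 < (R0 ^+ 2 + enorm x ^+ 2) `^ (a / 2).
Proof. by rewrite powR_gt0// ltr_pwDl ?exprn_gt0// sqr_ge0. Qed.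

Let wle x : (R0 ^+ 2 + enorm x ^+ 2) `^ (- (a / 2)) * `|phi x| <= B.
Proof. by rewrite powRN mulrC ler_pdivrMr//. Qed.

Lemma wnorm_le : wnorm R0 a phi <= B.
Proof.
apply: ge_sup; last by move=> _ [x _ <-].
by exists ((R0 ^+ 2 + enorm (0 : 'rV[R]_n) ^+ 2) `^ (- (a / 2)) * `|phi 0|); exists 0.
Qed.

(** [HB] bounds the set above, so that [sup] is an upper bound of it. *)
Lemma le_wnorm x : (R0 ^+ 2 + enorm x ^+ 2) `^ (- (a / 2)) * `|phi x| <= wnorm R0 a phi.
Proof.
apply: sup_upper_bound; last by exists x.
split; last by exists B => _ [y _ <-].
by exists ((R0 ^+ 2 + enorm x ^+ 2) `^ (- (a / 2)) * `|phi x|); exists x.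
Qed.

Lemma le_wnormM x : `|phi x| <= wnorm R0 a phi * (R0 ^+ 2 + enorm x ^+ 2) `^ (a / 2).
Proof. by rewrite -ler_pdivrMr// -powRN mulrC; exact: le_wnorm. Qed.

End wnorm.

(** By the reverse triangle inequality the weighted norm is continuous in time, so it attains a
    maximum on [[0, T]]. *)
Lemma C0BC_bounded n (a T : R) (mu : R -> 'rV[R]_n -> R) : 0 <= a -> 0 <= T -> C0BC a mu ->
  exists B, forall t x, 0 <= t <= T -> `|mu t x| <= B * (1 + enorm x ^+ 2) `^ (a / 2).
Proof.
move=> a0 T0 [HBC Hc].
have bnd t : 0 <= t -> exists B, forall x, `|mu t x| <= B * (1 ^+ 2 + enorm x ^+ 2) `^ (a / 2).
  by move=> t0; rewrite expr1n; exact: BC_bounded (HBC t t0).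
(* Times are clamped at 0, since [C0BC] speaks of nonnegative times; then [N] is continuous on the
   whole line. *)
pose N (t : R) := wnorm 1 a (mu (Num.max 0 t)).
have tri s t : 0 <= s -> 0 <= t ->
    wnorm 1 a (mu s) <= wnorm 1 a (mu t) + wnorm 1 a (fun x => mu s x - mu t x).
  move=> s0 t0; have [Bs Hs] := bnd s s0; have [Bt Ht] := bnd t t0.
  have Hd x : `|mu s x - mu t x| <= (Bs + Bt) * (1 ^+ 2 + enorm x ^+ 2) `^ (a / 2).
    by rewrite mulrDl; apply: (le_trans (ler_normB _ _)); rewrite lerD.
  apply: wnorm_le => // x; rewrite mulrDl.
  have := le_wnormM ltr01 Ht x; have := le_wnormM ltr01 Hd x.
  have := ler_normD (mu t x) (mu s x - mu t x); rewrite addrC subrK; lra.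
have sym s t : wnorm 1 a (fun x => mu s x - mu t x) = wnorm 1 a (fun x => mu t x - mu s x).
  by rewrite /wnorm; congr sup; apply: eq_imagel => x _; rewrite distrC.
have cN : continuous N.
  move=> t; apply/cvgrPdist_lt => e e0.
  have mt0 : 0 <= Num.max 0 t by rewrite le_max lexx.
  have [d d0 Hd] := Hc _ mt0 e e0.
  near=> s.
  have ms0 : 0 <= Num.max 0 s by rewrite le_max lexx.
  have hst : `|Num.max 0 s - Num.max 0 t| < d.
    apply: (@le_lt_trans _ _ `|s - t|); last by near: s; exact: cvgr_distC_lt.
    case: (leP 0 s) => hs; case: (leP 0 t) => ht; rewrite ?subrr ?normr0//.
    - by rewrite subr0 !ger0_norm; lra.
    - by rewrite sub0r normrN ger0_norm// ler0_norm; lra.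
  have h := Hd _ ms0 hst.
  have h1 := tri _ _ ms0 mt0; have h2 := tri _ _ mt0 ms0.
  rewrite sym in h2; rewrite /N ltr_norml; apply/andP; split; lra.
have [c _ Hmax] := EVT_max T0 (continuous_subspaceT (A := `[0, T]%classic) cN).
exists (N c) => t x tT; have /andP[t0 _] := tT.
have := Hmax t; rewrite in_itv/= tT => /(_ isT) h.
have [Bt Ht] := bnd t t0.
have := le_wnormM ltr01 Ht x; rewrite expr1n => /le_trans; apply.
rewrite ler_wpM2r ?powR_ge0//; apply: le_trans h; rewrite /N.
by rewrite (max_r t0).
Unshelve. all: by end_near. Qed.

(** The slack [m - 1 - nu] absorbs the subpolynomial [zeta] for large [t]; on the remaining compact
    interval [zeta] is bounded. *)
Lemma zeta_bound (zeta : R -> R) (nu m : R) : nu + 1 < m ->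
  {within `[0%R, +oo[, continuous zeta} ->
  (forall delta, 0 < delta -> t `^ (- delta) * zeta t @[t --> +oo] --> 0) ->
  exists2 C, 0 < C & forall t, 0 <= t -> zeta t * (1 + t) `^ nu <= C * (1 + t) `^ (m - 1).
Proof.
move=> num cz Hz; pose de := m - 1 - nu.
have de0 : 0 < de by rewrite /de; lra.
have /cvgrPdist_lt /(_ 1 ltr01) := Hz _ de0.
move=> [t1 [_ Ht1]].
pose t2 := Num.max 1 (t1 + 1).
have t21 : 1 <= t2 by rewrite le_max lexx.
have [||c _ Hmax] := @EVT_max R zeta 0 t2; first by lra.
  apply: continuous_subspaceW cz => x /=; rewrite !in_itv/= andbT => /andP[] //.
pose C := Num.max 1 (zeta c).
have C1 : 1 <= C by rewrite le_max lexx.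
exists C; first by lra.
move=> t t0.
have t1p : 0 < 1 + t by lra.
have -> : (1 + t) `^ (m - 1) = (1 + t) `^ de * (1 + t) `^ nu.
  rewrite -powRD; last by apply/implyP => _; rewrite gt_eqF.
  by rewrite /de subrK.
rewrite mulrA ler_wpM2r ?powR_ge0//.
have [tt2|tt2] := leP t t2.
  rewrite -[leLHS]mulr1; apply: (@le_trans _ _ (C * 1)).
    rewrite !mulr1 /C le_max; apply/orP; right; apply: Hmax.
    by rewrite in_itv/= t0.
  by rewrite ler_wpM2l ?powR_ge1//; lra.
have t1t : t1 < t.
  by apply: lt_trans tt2; rewrite lt_max; apply/orP; right; lra.
have := Ht1 t t1t => /=; rewrite sub0r normrN => /(le_lt_trans (ler_norm _)) h.
have tp : 0 < t by lra.
have : zeta t <= t `^ de.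
  move: h; rewrite powRN mulrC => /ltW; rewrite ler_pdivrMr ?powR_gt0//.
  by rewrite mul1r.
move=> /le_trans; apply; apply: (@le_trans _ _ ((1 + t) `^ de)).
  by rewrite powR_le//; lra.
by rewrite ler_peMl ?powR_ge0.
Qed.

End weights.

(** * Comparability of the weights *)

Section main_bounds.
Variable R : realType.
Notation MR := (measurableTypeR R).

Lemma rV_measurable_bessel_evenpoly N (b T : R) n (x : 'rV[R]_n) :
  rV_measurable (fun y => (bessel (x - y) * (evenpoly N T y `^ b)%:E)%E).
Proof.
move=> d' T' h c mh mc; apply: emeasurable_funM.
  apply: measurable_bessel => j.
  have -> : (fun t : T' => (x - c t)%R ord0 j) = (fun t => x ord0 j - c t ord0 j)%R.
    by apply: funext => t; rewrite !mxE.
  by apply: measurable_funB; [exact: measurable_cst|exact: mc].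
apply/measurable_EFinP; apply: (measurableT_comp (measurable_powR b)).
apply: measurable_sum => i; apply: measurable_funD => //.
by apply: measurable_funX; exact: mc.
Qed.

(** [T + |x|^2] is a sum of [n + 1] terms, so one of them is at least the mean. *)
Lemma evenpoly_ge N (T : R) n (x : 'rV[R]_n) : (0 < n)%N -> 1 <= T ->
  (T + enorm x ^+ 2) ^+ N <= n.+1%:R ^+ N * evenpoly N T x.
Proof.
move=> n0 T1; set Th := T + _.
have e0 := sqr_ge0 (enorm x).
have Th0 : 0 <= Th by rewrite /Th; lra.
have q0 i : 0 <= T ^+ N + x ord0 i ^+ (2 * N) by rewrite addr_ge0 ?expr2n_ge0// exprn_ge0//; lra.
have TP i : T ^+ N + x ord0 i ^+ (2 * N) <= evenpoly N T x.
  by rewrite /evenpoly (bigD1 i)//= lerDl sumr_ge0.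
have Tq i : T ^+ N <= T ^+ N + x ord0 i ^+ (2 * N) by rewrite lerDl expr2n_ge0.
have xq i : (x ord0 i ^+ 2) ^+ N <= T ^+ N + x ord0 i ^+ (2 * N).
  by rewrite exprM lerDr exprn_ge0//; lra.
have key : forall z, 0 <= z -> Th <= n.+1%:R * z -> z ^+ N <= evenpoly N T x ->
    Th ^+ N <= n.+1%:R ^+ N * evenpoly N T x.
  move=> z z0 h1 h2; apply: (@le_trans _ _ ((n.+1%:R * z) ^+ N)).
    by rewrite lerXn2r ?nnegrE// mulr_ge0.
  by rewrite exprMn ler_wpM2l ?exprn_ge0.
have [hT|hT] := leP Th (n.+1%:R * T).
  have T0 : 0 <= T by lra.
  by apply: (key T) => //; apply: le_trans (TP (Ordinal n0)).
have [i hi] : exists i, Th <= n.+1%:R * x ord0 i ^+ 2.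
  apply: contrapT => Hn.
  have H i : n.+1%:R * x ord0 i ^+ 2 < Th.
    by rewrite ltNge; apply/negP => h; apply: Hn; exists i.
  have hs : n.+1%:R * \sum_(i < n) x ord0 i ^+ 2 <= n%:R * Th.
    rewrite mulr_sumr; apply: (@le_trans _ _ (\sum_(i < n) Th)).
      by apply: ler_sum => i _; exact: ltW.
    by rewrite sumr_const card_ord mulr_natl.
  rewrite -sqr_enorm in hs.
  by move: hs hT; rewrite -natr1 /Th; lra.
by apply: (key (x ord0 i ^+ 2)) => //; [exact: sqr_ge0|exact: le_trans (TP i)].
Qed.

Lemma evenpoly_le N (T : R) n (x : 'rV[R]_n) : 1 <= T ->
  evenpoly N T x <= (2 * n%:R) * (T + enorm x ^+ 2) ^+ N.
Proof.
move=> T1; set Th := T + _; have e0 := sqr_ge0 (enorm x).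
have Th0 : 0 <= Th by rewrite /Th; lra.
apply: (@le_trans _ _ (\sum_(i < n) 2 * Th ^+ N)).
  apply: ler_sum => i _; rewrite mulr_natl mulr2n lerD//.
    by rewrite lerXn2r ?nnegrE ?/Th; lra.
  rewrite exprM lerXn2r ?nnegrE ?sqr_ge0//.
  by have := sqr_coord_le x i; rewrite /Th; lra.
by rewrite sumr_const card_ord -[leLHS]mulr_natr [leLHS]mulrAC.
Qed.

(** Splits off [T], the origin of [t^(a/2)] in the upper bound, and leaves the weight of
    [wnorm R0]. *)
Lemma sqrD_le (T R0 e : R) : 1 <= T -> 0 < R0 -> 0 <= e ->
  T + e <= (1 + R0 ^- 2) * T * (R0 ^+ 2 + e).
Proof.
move=> T1 R00 e0.
have r0 : 0 < R0 ^- 2 by rewrite invr_gt0 exprn_gt0.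
have r1 : R0 ^- 2 * R0 ^+ 2 = 1 by rewrite mulVf// expf_neq0// gt_eqF.
have r2 : 0 <= R0 ^+ 2 by rewrite sqr_ge0.
rewrite [leRHS](_ : _ = R0 ^- 2 * R0 ^+ 2 * T + R0 ^+ 2 * T + (1 + R0 ^- 2) * (T * e)); last by ring.
rewrite r1 mul1r.
have : e <= T * e by rewrite ler_peMl.
have : 0 <= R0 ^- 2 * (T * e) by rewrite mulr_ge0 ?mulr_ge0//; lra.
have : 0 <= R0 ^+ 2 * T by rewrite mulr_ge0//; lra.
lra.
Qed.

End main_bounds.

(** * Growth of the solution *)

Section solution.
Variable R : realType.
Notation MR := (measurableTypeR R).

Section weight.
Variables (n N : nat) (a : R).
Hypotheses (n0 : (0 < n)%N) (N0 : (0 < N)%N) (a0 : 0 < a).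

(** For [N >= a/2] the outer power is concave, while the growth in [x] is still [|x|^a]. *)
Definition polyweight (T : R) (x : 'rV[R]_n) : R := evenpoly N T x `^ (a / (2 * N%:R)).

Let b0 : 0 <= a / (2 * N%:R).
Proof. by rewrite divr_ge0 ?mulr_ge0// ltW. Qed.

Let powN (x : R) : 0 <= x -> (x ^+ N) `^ (a / (2 * N%:R)) = x `^ (a / 2).
Proof.
move=> x0; rewrite -powR_mulrn// -powRrM; congr (_ `^ _); field.
by rewrite pnatr_eq0 -lt0n.
Qed.

Lemma polyweight_gt0 (T : R) (x : 'rV[R]_n) : 1 <= T -> 0 < polyweight T x.
Proof. by move=> T1; rewrite powR_gt0// evenpoly_gt0. Qed.

Lemma polyweight_ge (T : R) (x : 'rV[R]_n) : 1 <= T ->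
  (T + enorm x ^+ 2) `^ (a / 2) <= (n.+1%:R ^+ N) `^ (a / (2 * N%:R)) * polyweight T x.
Proof.
move=> T1; have e0 := sqr_ge0 (enorm x).
have Th0 : 0 <= T + enorm x ^+ 2 by lra.
rewrite -powN// /polyweight -powRM ?exprn_ge0//; last exact/ltW/evenpoly_gt0.
by apply: powR_le => //; [rewrite exprn_ge0|exact: evenpoly_ge].
Qed.

Lemma polyweight_le (T : R) (x : 'rV[R]_n) : 1 <= T ->
  polyweight T x <= (2 * n%:R) `^ (a / (2 * N%:R)) * (T + enorm x ^+ 2) `^ (a / 2).
Proof.
move=> T1; have e0 := sqr_ge0 (enorm x).
have Th0 : 0 <= T + enorm x ^+ 2 by lra.
rewrite -powN// /polyweight -powRM ?exprn_ge0// ?mulr_ge0//.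
by apply: powR_le => //; [exact/ltW/evenpoly_gt0|exact: evenpoly_le].
Qed.

Lemma bessel_polyweight : a <= 2 * N%:R -> exists2 C : R, 0 < C &
  forall (T : R) (x : 'rV[R]_n) (c : R), 1 <= T -> 0 <= c ->
  (intRn (fun y => bessel (x - y) * (c * polyweight T y)%:E) <=
    (c * ((1 + C / T) * polyweight T x))%:E)%E.
Proof.
move=> aN; have [C C0 HC] := bessel_evenpoly_powR R N0 n0; exists C => // T x c T1 c0.
have N00 : 0 < 2 * N%:R :> R by rewrite mulr_gt0// ltr0n.
have b01 : 0 < a / (2 * N%:R) <= 1.
  by rewrite divr_gt0//= ler_pdivrMr// mul1r.
have -> : (fun y => (bessel (x - y) * (c * polyweight T y)%:E)%E) =
   (fun y => (c%:E * (bessel (x - y) * (polyweight T y)%:E))%E).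
  by apply/funext => y; rewrite EFinM muleCA.
rewrite intRnZl ?lee_fin//; last 2 first.
- exact: rV_measurable_bessel_evenpoly.
- by move=> y; rewrite mule_ge0 ?bessel_ge0// lee_fin powR_ge0.
by rewrite EFinM; apply: lee_wpmul2l; [rewrite lee_fin|exact: HC].
Qed.

End weight.

Lemma ler_pM3 (x X y Y z Z : R) : 0 <= x -> x <= X -> 0 <= y -> y <= Y -> 0 <= z -> z <= Z ->
  x * (y * z) <= X * (Y * Z).
Proof.
move=> x0 xX y0 yY z0 zZ; apply: ler_pM => //; first exact: mulr_ge0.
exact: ler_pM.
Qed.

(** * Upper and lower growth of a given solution *)

Section bounds.
Variables (n N : nat) (p nu sigma : R) (zeta : R -> R) (u0 : 'rV[R]_n -> R) (a : R)
  (u : R -> 'rV[R]_n -> R).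
Hypotheses (n0 : (0 < n)%N) (N0 : (0 < N)%N) (aN : a <= 2 * N%:R).
Hypotheses (p01 : 0 < p < 1) (sigma0 : 0 <= sigma).
Hypothesis zeta_cont : {within `[0%R, +oo[, continuous zeta}.
Hypothesis zeta_gt0 : forall t, 0 <= t -> 0 < zeta t.
Hypothesis zeta_small : forall delta, 0 < delta -> t `^ (- delta) * zeta t @[t --> +oo] --> 0.
Hypothesis ac_lt : (sigma + 2 * Num.max (nu + 1) 0) / (1 - p) < a.
Hypothesis u_sol : global_s_solution p (sigma / (1 - p)) a
    (fun x t => zeta t * (1 + t) `^ nu * enorm x `^ sigma) u0 u.

Notation mu := (fun t x => expR t * u t x).
Notation Phi := (@polyweight n N a).

Lemma ac_ltM : sigma + 2 * Num.max (nu + 1) 0 < a * (1 - p).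
Proof. by rewrite -ltr_pdivrMr//; have /andP[] := p01; lra. Qed.

Lemma exponent_gt0 : 0 < a.
Proof.
apply: le_lt_trans ac_lt; have /andP[_ p1] := p01.
have : 0 <= Num.max (nu + 1) 0 by rewrite le_max lexx orbT.
by move=> h; have s0 := sigma0; rewrite divr_ge0//; lra.
Qed.

(** [sigma / (1 - p) <= a_c < a], so the solution lives in the space of exponent [a]. *)
Lemma max_exponent : Num.max (sigma / (1 - p)) a = a.
Proof.
apply: max_r; apply/ltW; apply: le_lt_trans ac_lt; have /andP[_ p1] := p01.
rewrite ler_wpM2r ?invr_ge0 ?subr_ge0 ?(ltW p1)// lerDl mulr_ge0//.
by rewrite le_max lexx orbT.
Qed.

Lemma solution_ge0 (t : R) x : 0 <= t -> 0 <= u t x.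
Proof. by have [H _] := u_sol; exact: H. Qed.

(** [B] may depend on [T]: the bound provides finiteness and a start for the iteration, and at
    [T = 0] it controls [u0]. *)
Lemma solution_apriori (T : R) : 0 <= T -> exists2 B, 0 <= B &
  forall (t : R) x, 0 <= t <= T -> mu t x <= B * (1 + enorm x ^+ 2) `^ (a / 2).
Proof.
move=> T0; have [_ [Hc _]] := u_sol; rewrite max_exponent in Hc.
have [B HB] := C0BC_bounded (ltW exponent_gt0) T0 Hc.
exists (Num.max 0 B); first by rewrite le_max lexx.
move=> t x tT; apply: (le_trans (ler_norm _)); apply: (le_trans (HB t x tT)).
by rewrite ler_wpM2r ?powR_ge0// le_max lexx orbT.
Qed.

Lemma solution_init x : u0 x = mu 0 x.
Proof.
have [_ [_ /(_ 0 x (lexx 0))]] := u_sol; rewrite /int0 set_itv1 !integral_set1/= !addr0.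
by move=> ->.
Qed.

Lemma weight1_le (T : R) (x : 'rV[R]_n) : 1 <= T ->
  (1 + enorm x ^+ 2) `^ (a / 2) <= (n.+1%:R ^+ N) `^ (a / (2 * N%:R)) * Phi T x.
Proof.
move=> T1; apply: le_trans (polyweight_ge n0 N0 exponent_gt0 x T1).
have e0 := sqr_ge0 (enorm x); have a0 := exponent_gt0.
by apply: powR_le; lra.
Qed.

Lemma solution_apriori_weight (T : R) : 1 <= T -> exists2 M, 0 <= M &
  forall (t : R) x, 0 <= t <= T -> mu t x <= M * Phi T x.
Proof.
move=> T1; have T0 : 0 <= T by lra.
have [B B0 HB] := solution_apriori T0.
exists (B * (n.+1%:R ^+ N) `^ (a / (2 * N%:R))); first by rewrite mulr_ge0 ?powR_ge0.
move=> t x tT; apply: (le_trans (HB t x tT)); rewrite -mulrA ler_wpM2l//.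
exact: weight1_le.
Qed.

(** The weight and the rate depend on [T]; the point is that [C] does not. *)
Lemma solution_upper : exists2 C, 0 < C &
  forall (T : R) x, 1 <= T -> u T x <= C * Phi T x.
Proof.
have a0 := exponent_gt0; have /andP[p0 p1] := p01; have s0 := sigma0.
have acM := ac_ltM.
have mx0 : 0 <= Num.max (nu + 1) 0 by rewrite le_max lexx orbT.
have mxn : nu + 1 <= Num.max (nu + 1) 0 by rewrite le_max lexx.
(* [a > a_c] amounts to [m > max(nu + 1, 0)]. *)
pose m := (a * (1 - p) - sigma) / 2.
have m0 : 0 < m by rewrite /m; lra.
have num : nu + 1 < m by rewrite /m; lra.
have [Cz Cz0 Hz] := zeta_bound num zeta_cont zeta_small.
have [C C0 HB] := bessel_polyweight n0 N0 a0 aN.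
have [B0 B00 HB0] := solution_apriori (lexx 0).
pose c1 : R := (n.+1%:R ^+ N) `^ (a / (2 * N%:R)).
have c10 : 0 < c1 by rewrite powR_gt0// exprn_gt0.
pose A0 := Num.max 1 (B0 * c1).
have A01 : 1 <= A0 by rewrite le_max lexx.
(* [1 + C] bounds [al], [Cz / m] turns [zeta_bound] into the derivative of [(1 + t)^m], and the
   power of [c1] comes from [polyweight_ge]. *)
pose K0 := (1 + C) * (Cz / m) * c1 `^ (1 - p).
have K00 : 0 < K0 by rewrite !mulr_gt0 ?invr_gt0 ?powR_gt0//; lra.
exists (A0 * expR (C + K0 * 2 `^ m)).
  by rewrite mulr_gt0 ?expR_gt0//; lra.
move=> T x T1; have T0 : 0 < T by lra.
have [M M0 HM] := solution_apriori_weight T1.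
pose ka := K0 * T `^ (- m); pose al := 1 + C / T.
have CT : 0 <= C / T by rewrite divr_ge0// ltW.
have al1 : 1 <= al by rewrite /al; lra.
have alC : al <= 1 + C by rewrite /al lerD2l ler_pdivrMr// ler_peMr// ltW.
have ka0 : 0 <= ka by rewrite mulr_ge0 ?powR_ge0// ltW.
have Phi0 y : 0 < Phi T y by exact: polyweight_gt0.
have V0 (y : 'rV[R]_n) (t : R) : 0 <= t <= T -> 0 <= zeta t * (1 + t) `^ nu * enorm y `^ sigma.
  by move=> /andP[t0 _]; rewrite !mulr_ge0 ?powR_ge0// ltW// zeta_gt0.
have sPhi (y : 'rV[R]_n) : enorm y `^ sigma * Phi T y `^ p <= T `^ (- m) * c1 `^ (1 - p) * Phi T y.
  have e0 := sqr_ge0 (enorm y).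
  have Th0 : 0 < T + enorm y ^+ 2 by lra.
  (* [|y|^sigma T^m <= (T + |y|^2)^(sigma/2 + m)], and the exponent equals [a(1-p)/2] by the choice
     of [m]. *)
  have h1 : enorm y `^ sigma * T `^ m <= (c1 * Phi T y) `^ (1 - p).
    apply: (@le_trans _ _ (((T + enorm y ^+ 2) `^ (a / 2)) `^ (1 - p))).
      rewrite -powRrM (_ : a / 2 * (1 - p) = sigma / 2 + m); last by rewrite /m; field.
      rewrite powRD; last by apply/implyP => _; rewrite gt_eqF.
      rewrite -powR_half ?enorm_ge0//; apply: ler_pM; rewrite ?powR_ge0//.
        by apply: powR_le; lra.
      by apply: powR_le; lra.
    by apply: powR_le; [lra|exact: powR_ge0|exact: polyweight_ge].
  have PE : Phi T y = Phi T y `^ (1 - p) * Phi T y `^ p.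
    rewrite -powRD; last by apply/implyP => _; rewrite gt_eqF.
    by rewrite subrK powRr1// ltW.
  rewrite [in leRHS]PE.
  rewrite [leRHS]mulrA -[X in _ <= X * _]mulrA.
  rewrite ler_wpM2r ?powR_ge0// -powRM ?(ltW c10) ?(ltW (Phi0 y))//.
  by rewrite powRN ler_pdivlMl ?powR_gt0// mulrC.
have HV (y : 'rV[R]_n) (t : R) : 0 <= t <= T ->
    al * (zeta t * (1 + t) `^ nu * enorm y `^ sigma * Phi T y `^ p) <=
    ka * (m * (1 + t) `^ (m - 1)) * Phi T y.
  move=> tT; have /andP[t0 _] := tT.
  rewrite [leRHS](_ : _ = (1 + C) * (Cz * (1 + t) `^ (m - 1) *
     (T `^ (- m) * c1 `^ (1 - p) * Phi T y))); last by rewrite /ka /K0; field; rewrite gt_eqF.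
  have z0 : 0 <= zeta t * (1 + t) `^ nu by rewrite mulr_ge0 ?powR_ge0// ltW// zeta_gt0.
  have al0 : 0 <= al by lra.
  rewrite -[in leLHS]mulrA.
  apply: (ler_pM3 al0 alC z0 (Hz t t0) _ (sPhi y)).
  exact: (mulr_ge0 (powR_ge0 _ _) (powR_ge0 _ _)).
have mu0 (t : R) y : 0 <= t <= T -> 0 <= mu t y.
  by move=> /andP[t0 _]; rewrite mulr_ge0 ?expR_ge0// solution_ge0.
have u0le y : u0 y <= A0 * Phi T y.
  rewrite solution_init; apply: (@le_trans _ _ (B0 * (1 + enorm y ^+ 2) `^ (a / 2))).
    by apply: HB0; rewrite lexx.
  apply: (@le_trans _ _ (B0 * (c1 * Phi T y))).
    by rewrite ler_wpM2l//; exact: weight1_le.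
  by rewrite mulrA ler_wpM2r ?(ltW (Phi0 y))// le_max lexx orbT.
have [_ [_ mueq]] := u_sol.
have HB' x' (c : R) : 0 <= c ->
  (intRn (fun y => bessel (x' - y) * (c * Phi T y)%:E) <= (c * (al * Phi T x'))%:E)%E.
  by move=> c0; exact: HB.
have TT : 0 <= T <= T by rewrite lexx ltW.
have Phi0' y : 0 <= Phi T y by exact: ltW.
have := @upper_comparison R n p al ka m A0 T _ u0 mu (Phi T) p01 al1 ka0 m0 (ltW T0) A01
  Phi0' HB' V0 HV mu0 _ u0le T x (ex_intro _ M HM) TT.
move=> /(_ (fun t y tT => mueq t y (proj1 (andP tT)))) H.
have {}H : u T x <= expR (- T) * (A0 * expR (rate al ka m T) * Phi T x).
  by rewrite expRN mulrC ler_pdivlMr ?expR_gt0// mulrC.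
apply: (le_trans H).
rewrite [leLHS](_ : _ = A0 * (expR (- T) * expR (rate al ka m T)) * Phi T x); last by ring.
rewrite ler_wpM2r// ler_wpM2l//; first by lra.
rewrite -expRD ler_expR /rate.
have -> : al * T = T + C by rewrite /al mulrDl mul1r divfK// gt_eqF.
(* [1 + T <= 2 T], so the powers of [T] cancel and [E T - T] stays bounded. *)
have h : ka * (1 + T) `^ m <= K0 * 2 `^ m.
  rewrite /ka -mulrA ler_wpM2l ?(ltW K00)// powRN ler_pdivrMl ?powR_gt0// -powRM//; last by lra.
  by apply: powR_le; lra.
lra.
Qed.

Lemma solution_lower (l r0 : R) : 0 < l -> 0 < r0 ->
  (forall x, r0 <= enorm x -> l * enorm x `^ a <= u0 x) ->
  exists c T0 : R, [/\ 0 < c, 1 <= T0 & forall T : R, T0 <= T -> c * l * T `^ (a / 2) <= u T 0].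
Proof.
move=> l0 r00 Hu0; have a0 := exponent_gt0.
have [c0 c00 Hgap] := cosgap_ge R.
have be0 := @cos1_gt0 R.
pose be : R := cos 1.
(* Chosen so that [r^2 = T / L] gives [cosgap (1/r) * T >= 2 / cos 1]. *)
pose L := 2 / be / c0.
have L0 : 0 < L by rewrite !divr_gt0.
have [C C0 HB] := bessel_polyweight n0 N0 a0 aN.
(* [T >= L] yields [k <= 1], as [cosgap_ge] requires, and [T >= L r0^2] yields [r >= r0]. *)
pose T0 := Num.max 1 (Num.max L (L * r0 ^+ 2)).
exists (be / 4 * L `^ (- (a / 2))), T0; split.
- by rewrite mulr_gt0 ?powR_gt0// divr_gt0.
- by rewrite le_max lexx.
move=> T; rewrite !ge_max => /and3P[T1 TL Tr].
have Tp : 0 < T by lra.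
pose r := Num.sqrt (T / L).
have TLp : 0 < T / L by rewrite divr_gt0.
have r2 : r ^+ 2 = T / L by rewrite sqr_sqrtr// ltW.
have rp : 0 < r by rewrite sqrtr_gt0.
have r1 : 1 <= r.
  by rewrite -(ler_pXn2r (_ : (0 < 2)%N))// ?nnegrE ?(ltW rp)// expr1n r2 ler_pdivlMr// mul1r.
have rr0 : r0 <= r.
  by rewrite -(ler_pXn2r (_ : (0 < 2)%N))// ?nnegrE ?(ltW rp) ?(ltW r00)// r2 ler_pdivlMr// mulrC.
pose k := r^-1.
have k01 : 0 < k <= 1 by rewrite invr_gt0 rp invf_le1.
have k0 : 0 < k by have /andP[] := k01.
have gapk := Hgap k k01.
(* The factor [1/2] compensates [be - cos <= 2]. *)
pose cc := l / 2 * r `^ a.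
have cc0 : 0 < cc by rewrite mulr_gt0 ?powR_gt0//; lra.
pose i : 'I_n := Ordinal n0.
have pi2 := @pi_ge2 R.
(* For [|x_1| < r] the left-hand side is nonpositive; otherwise [|x| >= r] and the growth of [u0]
   applies. *)
have u0ge (x : 'rV[R]_n) : cc * (be - cos (k * x ord0 i)) <= u0 x.
  have [xr|xr] := leP r `|x ord0 i|.
    have xr' : r <= enorm x by apply: le_trans (coord_le_enorm x i).
    apply: le_trans (Hu0 x (le_trans rr0 xr')).
    apply: (@le_trans _ _ (l * r `^ a)); last first.
      by rewrite ler_wpM2l ?(ltW l0)//; apply: powR_le => //; exact: ltW.
    rewrite /cc [leLHS](_ : _ = l * r `^ a * ((be - cos (k * x ord0 i)) / 2)); last by field.
    rewrite ler_piMr ?mulr_ge0 ?powR_ge0 ?(ltW l0)//.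
    by have := cos_geN1 (k * x ord0 i); have := @cos_le1 R 1; rewrite /be; lra.
  apply: (@le_trans _ _ 0); last by rewrite solution_init mulr_ge0 ?expR_ge0// solution_ge0.
  rewrite mulr_ge0_le0 ?(ltW cc0)// subr_le0 /be.
  have -> : cos (k * x ord0 i) = cos `|k * x ord0 i|.
    by case: (leP 0 (k * x ord0 i)) => h; [rewrite ger0_norm|rewrite ltr0_norm// cosN].
  have h1 : `|k * x ord0 i| <= 1.
    by rewrite normrM gtr0_norm// /k mulrC ler_pdivrMr// mul1r ltW.
  rewrite leNgt ltr_cos ?in_itv/=; [by rewrite -leNgt| |]; apply/andP; split => //; lra.
have [M M0 HM] := solution_apriori_weight T1.
have HB' x' (c : R) : 0 <= c ->
  (intRn (fun y => bessel (x' - y) * (c * Phi T y)%:E) <= (c * ((1 + C / T) * Phi T x'))%:E)%E.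
  by move=> c0'; exact: HB.
have [_ [_ mueq]] := u_sol.
have mub (t : R) x : 0 <= t <= T -> 0 <= mu t x <= M * Phi T x.
  move=> tT; rewrite HM// andbT mulr_ge0 ?expR_ge0// solution_ge0//.
  by have /andP[] := tT.
have muge (t : R) x : 0 <= t <= T -> u0 x + int0 t (fun tau => Bop (mu tau) x) <= mu t x.
  move=> /andP[t0 _]; rewrite mueq// lerDl; apply: int0_ge0 => s /andP[s0 _].
  rewrite mulr_ge0 ?expR_ge0// Bop_ge0// => y.
  by rewrite !mulr_ge0 ?powR_ge0// ltW// zeta_gt0.
have TT : 0 <= T <= T by rewrite lexx ltW.
have be1 : be <= 1 by exact: cos_le1.
have := @lower_comparison R n i (1 + C / T) be k cc T M u0 mu (Phi T) (ltW cc0) be1 M0 HB'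
   mub muge u0ge T 0 TT.
rewrite mxE mulr0 cos0 mulr1 => H.
set g := cosgap k in gapk H.
have gT : 2 / be <= g * T.
  have : c0 * k ^+ 2 * T <= g * T by rewrite ler_wpM2r// ltW.
  rewrite exprVn r2 invf_div /L; apply: le_trans.
  by rewrite le_eqVlt; apply/orP; left; apply/eqP; field; rewrite !gt_eqF.
(* [e^(gT) >= 1 + gT >= 2 / be]: relative to [e^T], the cosine part has decayed to at most half of
   the constant part. *)
have eg : expR (- (g * T)) <= be / 2.
  rewrite expRN; have := expR_ge1Dx (g * T) => h.
  have h2 : 2 / be <= expR (g * T) by lra.
  have b2 : 0 < 2 / be by rewrite divr_gt0.
  by rewrite -[leRHS]invrK lef_pV2 ?posrE ?expR_gt0 ?invr_gt0 ?divr_gt0// invf_div.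
have el : expR ((1 - g) * T) = expR T * expR (- (g * T)).
  by rewrite -expRD; congr expR; ring.
have H3 : cc * (be / 2) <= u T 0.
  rewrite -(ler_pM2l (expR_gt0 T)); apply: le_trans H; rewrite el.
  rewrite [leRHS](_ : _ = expR T * (cc * (be - expR (- (g * T))))); last by ring.
  by rewrite ler_wpM2l ?expR_ge0// ler_wpM2l ?(ltW cc0)//; lra.
apply: le_trans H3; rewrite /cc.
have -> : r `^ a = L `^ (- (a / 2)) * T `^ (a / 2).
  rewrite -powR_half ?(ltW rp)// r2 mulrC powRM ?invr_ge0 ?(ltW L0) ?(ltW Tp)//.
  by rewrite -(powR_inv1 (ltW L0)) -powRrM mulN1r mulrC.
by rewrite le_eqVlt; apply/orP; left; apply/eqP; field.
Qed.

End bounds.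
End solution.

(** * The initial datum at infinity and the two-sided estimate *)

Section main_aux.
Variable R : realType.

Lemma enorm0 n : enorm (0 : 'rV[R]_n) = 0.
Proof. by rewrite /enorm big1 ?sqrtr0// => i _; rewrite mxE expr0n. Qed.

(** At one large radius the infimum exceeds [l/2], which settles all points beyond that radius. *)
Lemma inf_outside_lower n (u0 : 'rV[R]_n -> R) (a l : R) : 0 < l ->
  inf_outside (fun x => enorm x `^ (- a) * u0 x) r @[r --> +oo] --> l%:E ->
  exists2 r0, 0 < r0 & forall x, r0 <= enorm x -> l / 2 * enorm x `^ a <= u0 x.
Proof.
move=> l0 Hinf.
have : nbhs l%:E [set y | ((l / 2)%:E < y)%E].
  apply: open_nbhs_nbhs; split; first exact: open_ereal_gt_ereal.
  by rewrite /= lte_fin; lra.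
move=> /Hinf [M [_ HM]].
(* The 1 keeps [|x|] positive; [M + 1] lies strictly beyond [M]. *)
exists (Num.max 1 (M + 1)); first by rewrite lt_max ltr01.
move=> x xr.
pose g (y : 'rV[R]_n) : R := enorm y `^ (- a) * u0 y.
have h : ((l / 2)%:E < inf_outside g (Num.max 1 (M + 1))%R)%E.
  by apply: HM; rewrite lt_max; apply/orP; right; lra.
have x0 : 0 < enorm x by apply: lt_le_trans xr; rewrite lt_max ltr01.
have : ((l / 2)%:E < (g x)%:E)%E.
  by apply: (lt_le_trans h); apply: ereal_inf_lbound; exists x.
by rewrite lte_fin /g powRN => /ltW; rewrite ler_pdivlMl ?powR_gt0// mulrC.
Qed.

End main_aux.

Unset Implicit Arguments.

Theorem mainTheorem8 (R : realType) (n : nat) (p nu sigma : R)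
  (zeta : R -> R) (u0 : 'rV[R]_n -> R) (a l1 l2 R0 : R)
  (u : R -> 'rV[R]_n -> R) :
  (1 <= n)%N -> 0 < p < 1 -> Jplus n sigma ->
  {within `[0%R, +oo[, continuous zeta} ->
  (forall t, 0 <= t -> 0 < zeta t) ->
  (forall delta, 0 < delta -> t `^ delta * zeta t @[t --> +oo] --> +oo) ->
  (forall delta, 0 < delta -> t `^ (- delta) * zeta t @[t --> +oo] --> 0) ->
  (0 < sigma -> exists2 eps, 0 < eps < 1 &
      E_class eps (fun t => zeta t * (1 + t) `^ nu)) ->
  continuous u0 -> (forall x, 0 <= u0 x) ->
  0 < l1 -> 0 < l2 ->
  inf_outside (fun x => enorm x `^ (- a) * u0 x) r @[r --> +oo] --> l1%:E ->
  sup_outside (fun x => enorm x `^ (- a) * u0 x) r @[r --> +oo] --> l2%:E ->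
  (sigma + 2 * Num.max (nu + 1) 0) / (1 - p) < a ->
  0 < R0 ->
  global_s_solution p (sigma / (1 - p)) a
    (fun x t => zeta t * (1 + t) `^ nu * enorm x `^ sigma) u0 u ->
  exists Cl Cu : R, 0 < Cl /\ 0 < Cu /\
    \forall t \near +oo,
      Cl * l1 * t `^ (a / 2) <= wnorm R0 a (u t) <= Cu * l2 * t `^ (a / 2).
Proof.
move=> n1 p01 Js cz z0 _ zs _ _ _ l10 l20 Hinf _ ac R00 sol.
have s0 : 0 <= sigma by move: Js; rewrite /Jplus; case: ifP => // _ [->|]; lra.
have a0 := exponent_gt0 p01 s0 ac.
pose N := Num.bound a.
have aN : a < N%:R by apply: archi_boundP; exact: ltW.
have N0 : (0 < N)%N by rewrite -(ltr0n R); exact: lt_trans aN.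
have aN2 : a <= 2 * N%:R by lra.
have [C C0 HC] := solution_upper n1 N0 aN2 p01 s0 cz z0 zs ac sol.
have [r0 r00 Hu0] := inf_outside_lower l10 Hinf.
have l120 : 0 < l1 / 2 by lra.
have [c [T0 [c0 T01 Hc]]] := solution_lower n1 N0 aN2 p01 s0 z0 ac sol l120 r00 Hu0.
(* The factors come from [solution_upper], [polyweight_le] and [sqrD_le]. *)
pose D : R := C * (2 * n%:R) `^ (a / (2 * N%:R)) * (1 + R0 ^- 2) `^ (a / 2).
have n0 : 0 < 2 * n%:R :> R by rewrite mulr_gt0// ltr0n.
have R02 : 0 < R0 ^- 2 by rewrite invr_gt0 exprn_gt0.
have D0 : 0 < D by rewrite !mulr_gt0 ?powR_gt0//; lra.
(* The lower constant collects the half lost in [inf_outside_lower] and the weight at the origin;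
   [D] bounds the norm without the factor [l2], hence the quotient. *)
exists (c / 2 * (R0 ^+ 2) `^ (- (a / 2))), (D / l2); split; [|split].
- by rewrite mulr_gt0 ?powR_gt0 ?exprn_gt0// divr_gt0.
- by rewrite divr_gt0.
near=> T.
have TT0 : T0 <= T by near: T; apply: nbhs_pinfty_ge; rewrite num_real.
have T1 : 1 <= T by lra.
have HD x : `|u T x| <= D * T `^ (a / 2) * (R0 ^+ 2 + enorm x ^+ 2) `^ (a / 2).
  have e0 := sqr_ge0 (enorm x).
  rewrite ger0_norm; last by apply: (solution_ge0 sol); lra.
  apply: (le_trans (HC T x T1)); rewrite /D -!mulrA ler_wpM2l ?(ltW C0)//.
  apply: (le_trans (polyweight_le n1 N0 a0 x T1)); rewrite ler_wpM2l ?powR_ge0//.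
  have T0' : 0 <= T by lra.
  have R2 : 0 <= R0 ^+ 2 by rewrite sqr_ge0.
  rewrite mulrA -powRM//; last by lra.
  rewrite -powRM; [|by rewrite mulr_ge0//; lra|by rewrite addr_ge0].
  by apply: powR_le; [lra|lra|exact: sqrD_le].
apply/andP; split.
  apply: le_trans (le_wnorm R00 HD 0).
  rewrite enorm0 expr0n/= addr0.
  have u0' : 0 <= u T 0 by apply: (solution_ge0 sol); lra.
  rewrite (ger0_norm u0').
  rewrite [leLHS](_ : _ = (R0 ^+ 2) `^ (- (a / 2)) * (c * (l1 / 2) * T `^ (a / 2))); last by field.
  by rewrite ler_wpM2l ?powR_ge0//; exact: Hc.
by rewrite divfK ?gt_eqF//; exact: wnorm_le HD.
Unshelve. all: by end_near. Qed.
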